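(* Let $\mathfrak{g}$ be the linear span in $\mathsf{H}_c\otimes\mathcal{C}$ of the elements $$H=\sum_i\tfrac12(x_iy_i+y_ix_i)\otimes1,\quad Z=\sum_i1\otimes\tfrac12(x_iy_i-y_ix_i)+\Omega_c,\quad E_1^+=-\sum_i\tfrac12x_i^2\otimes1,\quad E_1^-=\sum_i\tfrac12y_i^2\otimes1,$$ $$E_2^+=\sum_iy_i\otimes x_i,\quad E_2^-=\sum_ix_i\otimes y_i,\quad E_3^+=-\sum_ix_i\otimes x_i,\quad E_3^-=-\sum_iy_i\otimes y_i.$$ Then the subspace $\mathfrak{g}$ of $\mathsf{H}_c\otimes\mathcal{C}$ (with the supercommutator) is a Lie superalgebra isomorphic to $\mathfrak{spo}(2|2,\mathbb{C})$.
   Context: Let $E=\mathbb{R}^r$ be a Euclidean space with inner product $(\cdot,\cdot)$, identified with $E^*$ by means of it. Let $R\subseteq E^*$ be a finite root system (not necessarily crystallographic), $R_+$ a set of positive roots (write $\alpha>0$ for $\alpha\in R_+$), $W$ the finite real reflection group generated by the reflections $s_\alpha$, and $\alpha^\vee=2\alpha/(\alpha,\alpha)$ viewed in $E$. Let $c:R\to\mathbb{C}$, $\alpha\mapsto c_\alpha$, be $W$-invariant. Put $\mathfrak{h}=E\otimes_{\mathbb{R}}\mathbb{C}$ and let $\langle\cdot,\cdot\rangle:\mathfrak{h}^*\times\mathfrak{h}\to\mathbb{C}$ be the natural pairing. The rational Cherednik algebra $\mathsf{H}_c$ is the quotient of $T(\mathfrak{h}\oplus\mathfrak{h}^* )\#W$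 by the relations $[y,y']=0=[x,x']$ and $[y,x]=\langle x,y\rangle-\sum_{\alpha>0}c_\alpha\langle\alpha,y\rangle\langle x,\alpha^\vee\rangle s_\alpha$ for $y,y'\in\mathfrak{h}$, $x,x'\in\mathfrak{h}^*$. Fix an orthonormal basis $\{y_i\}$ of $E\subseteq\mathfrak{h}$ with dual basis $\{x_i\}\subseteq E^*\subseteq\mathfrak{h}^*$. $\mathcal{C}$ is the complex Clifford algebra generated by $\mathfrak{h}\oplus\mathfrak{h}^*$ with relations $vv'+v'v=B(v,v')$, where $B$ is symmetric, extends $\langle\cdot,\cdot\rangle$, and vanishes on $\mathfrak{h}\times\mathfrak{h}$ and $\mathfrak{h}^*\times\mathfrak{h}^*$. The product in $\mathsf{H}_c\otimes\mathcal{C}$ is $(a\otimes u)(b\otimes v)=ab\otimes uv$, and the parity is the parity of the $\mathcal{C}$-factor (elements of $\mathfrak{h}\oplus\mathfrak{h}^*\subset\mathcal{C}$ are odd). $\tau_\alpha=1-\alpha\alpha^\vee\in\mathcal{C}$ and $\Omega_c=\sum_{\alpha>0}c_\alpha s_\alpha\otimes\tau_\alpha$. $\mathfrak{spo}(2|2,\mathbb{C})$ is the Lie superalgebra (under the supercommutator) of complex matrices $\begin{pmatrix} a & b & y & u \\ c & -a & -v & -x \\ x & u & d & 0 \\ v & y & 0 & -d \end{pmatrix}$ with $a,b,c,d,x,y,u,v\in\mathbb{C}$, whose even part is the $2\times2$ block-diagonal part and odd part the block off-diagonal part. *)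

(* Defs.v *)
From HB Require Import structures.
From mathcomp Require Import all_boot all_order all_algebra.
From mathcomp Require Import generic_quotient finmap.
From mathcomp Require Import boolp classical_sets reals.
From mathcomp.real_closed Require Import complex.

Set Implicit Arguments.
Unset Strict Implicit.
Unset Printing Implicit Defensive.

Import GRing.Theory Num.Theory.
Local Open Scope ring_scope.
Local Open Scope quotient_scope.
Local Open Scope classical_set_scope.

(** MathComp's [algType] requires [1 != 0], which is not available for an
    algebra given by generators and relations. *)

Record pzAlgType (K : pzRingType) := PzAlgType {
  pz_ring : pzRingType;
  pz_scale : K -> pz_ring -> pz_ring;
  pz_scaleA : forall a b v, pz_scale a (pz_scale b v) = pz_scale (a * b) v;
  pz_scale1 : left_id 1 pz_scale;
  pz_scaleDr : right_distributive pz_scale +%R;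
  pz_scaleDl : forall v, {morph pz_scale^~ v : a b / a + b};
  pz_scaleAl : forall a u v, pz_scale a (u * v) = pz_scale a u * v;
  pz_scaleAr : forall a u v, pz_scale a (u * v) = u * pz_scale a v
}.

Definition pz_sort (K : pzRingType) (A : pzAlgType K) : Type := pz_ring A.
Coercion pz_sort : pzAlgType >-> Sortclass.

HB.instance Definition _ (K : pzRingType) (A : pzAlgType K) :=
  GRing.PzRing.copy (pz_sort A) (pz_ring A).
HB.instance Definition _ (K : pzRingType) (A : pzAlgType K) :=
  GRing.Zmodule_isLmodule.Build K (pz_sort A)
    (@pz_scaleA K A) (@pz_scale1 K A) (@pz_scaleDr K A) (@pz_scaleDl K A).

Lemma pzscalerAl (K : pzRingType) (A : pzAlgType K) (k : K) (u v : A) :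
  k *: (u * v) = (k *: u) * v.
Proof. exact: pz_scaleAl. Qed.

Lemma pzscalerAr (K : pzRingType) (A : pzAlgType K) (k : K) (u v : A) :
  k *: (u * v) = u * (k *: v).
Proof. exact: pz_scaleAr. Qed.

Definition mx_alg (K : comPzRingType) (n : nat) : pzAlgType K :=
  @PzAlgType K 'M[K]_n (fun k (M : 'M[K]_n) => k *: M)
    (@scalerA _ _) (@scale1r _ _) (@scalerDr _ _)
    (fun v k l => scalerDl v k l)
    (fun k u v => scalemxAl k u v) (fun k u v => scalemxAr k u v).

Inductive fterm (K X : Type) : Type :=
| FGen of X
| FZero
| FOne
| FAdd of fterm K X & fterm K X
| FOpp of fterm K X
| FMul of fterm K X & fterm K X
| FScale of K & fterm K X.

Arguments FGen {K X}.
Arguments FZero {K X}.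
Arguments FOne {K X}.

HB.instance Definition _ (K X : Type) := gen_eqMixin (fterm K X).
HB.instance Definition _ (K X : Type) := gen_choiceMixin (fterm K X).

Declare Scope fterm_scope.
Delimit Scope fterm_scope with T.
Bind Scope fterm_scope with fterm.
Notation "0" := FZero : fterm_scope.
Notation "1" := FOne : fterm_scope.
Notation "s + t" := (FAdd s t) : fterm_scope.
Notation "- t" := (FOpp t) : fterm_scope.
Notation "s - t" := (FAdd s (FOpp t)) : fterm_scope.
Notation "s * t" := (FMul s t) : fterm_scope.
Notation "k *: t" := (FScale k%R t) : fterm_scope.

(** The smallest congruence containing the relations [rel] for which the
    quotient is an associative unital [K]-algebra. *)
Inductive fcong (K : pzRingType) (X : Type)
    (rel : fterm K X -> fterm K X -> Prop) : fterm K X -> fterm K X -> Prop :=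
| FCrel s t : rel s t -> fcong rel s t
| FCrefl s : fcong rel s s
| FCsym s t : fcong rel s t -> fcong rel t s
| FCtrans s t u : fcong rel s t -> fcong rel t u -> fcong rel s u
| FCadd s s' t t' :
    fcong rel s s' -> fcong rel t t' -> fcong rel (s + t) (s' + t')
| FCopp s s' : fcong rel s s' -> fcong rel (- s) (- s')
| FCmul s s' t t' :
    fcong rel s s' -> fcong rel t t' -> fcong rel (s * t) (s' * t')
| FCscale k s s' : fcong rel s s' -> fcong rel (k *: s) (k *: s')
| FCaddA s t u : fcong rel (s + (t + u)) (s + t + u)
| FCaddC s t : fcong rel (s + t) (t + s)
| FCadd0 s : fcong rel (0 + s) s
| FCaddN s : fcong rel (- s + s) 0
| FCmulA s t u : fcong rel (s * (t * u)) (s * t * u)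
| FCmul1l s : fcong rel (1 * s) s
| FCmul1r s : fcong rel (s * 1) s
| FCmulDl s t u : fcong rel ((s + t) * u) (s * u + t * u)
| FCmulDr s t u : fcong rel (s * (t + u)) (s * t + s * u)
| FCscaleA k l s : fcong rel (k *: (l *: s)) ((k * l) *: s)
| FCscale1 s : fcong rel (1 *: s) s
| FCscaleDr k s t : fcong rel (k *: (s + t)) (k *: s + k *: t)
| FCscaleDl k l s : fcong rel ((k + l) *: s) (k *: s + l *: s)
| FCscaleAl k s t : fcong rel (k *: (s * t)) (k *: s * t)
| FCscaleAr k s t : fcong rel (k *: (s * t)) (s * (k *: t)).

Section PresentedAlgebra.
Context (K : pzRingType) (X : Type).
Context (rel : fterm K X -> fterm K X -> Prop).

Definition fcongb (s t : fterm K X) : bool := `[< fcong rel s t >].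

Lemma fcongb_refl : reflexive fcongb.
Proof. by move=> s; apply/asboolP; apply: FCrefl. Qed.

Lemma fcongb_sym : symmetric fcongb.
Proof.
by move=> s t; apply/asboolP/asboolP => h; apply: FCsym.
Qed.

Lemma fcongb_trans : transitive fcongb.
Proof.
by move=> t s u /asboolP h1 /asboolP h2; apply/asboolP; apply: FCtrans h2.
Qed.

Canonical fcong_equiv := EquivRel fcongb fcongb_refl fcongb_sym fcongb_trans.

Definition pquot : Type := {eq_quot fcong_equiv}.

HB.instance Definition _ := Choice.on pquot.
HB.instance Definition _ := EqQuotient.on pquot.

Let qcl (t : fterm K X) : pquot := \pi t.

Lemma qpclP s t : qcl s = qcl t <-> fcong rel s t.
Proof.
split=> [/eqmodP|] h; first by apply/asboolP.
by apply/eqmodP/asboolP.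
Qed.

Lemma qpcl_repr (a : pquot) : qcl (repr a) = a.
Proof. exact: reprK. Qed.

Lemma qpcl_ind (P : pquot -> Prop) : (forall t, P (qcl t)) -> forall a, P a.
Proof. by move=> h a; rewrite -(qpcl_repr a). Qed.

Lemma qrepr_qcl t : fcong rel (repr (qcl t)) t.
Proof. by apply/qpclP; rewrite qpcl_repr. Qed.

Definition padd (a b : pquot) := qcl (repr a + repr b).
Definition popp (a : pquot) := qcl (- repr a).
Definition pmul (a b : pquot) := qcl (repr a * repr b).
Definition pscale (k : K) (a : pquot) := qcl (k *: repr a).

Lemma paddE s t : padd (qcl s) (qcl t) = qcl (s + t).
Proof. by apply/qpclP; apply: FCadd; apply: qrepr_qcl. Qed.
Lemma poppE s : popp (qcl s) = qcl (- s).
Proof. by apply/qpclP; apply: FCopp; apply: qrepr_qcl. Qed.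
Lemma pmulE s t : pmul (qcl s) (qcl t) = qcl (s * t).
Proof. by apply/qpclP; apply: FCmul; apply: qrepr_qcl. Qed.
Lemma pscaleE k s : pscale k (qcl s) = qcl (k *: s).
Proof. by apply/qpclP; apply: FCscale; apply: qrepr_qcl. Qed.

Let pE := (paddE, poppE, pmulE, pscaleE).

Fact paddA : associative padd.
Proof.
by do 3!elim/qpcl_ind=> ?; rewrite !pE; apply/qpclP; constructor.
Qed.
Fact paddC : commutative padd.
Proof. by do 2!elim/qpcl_ind=> ?; rewrite !pE; apply/qpclP; constructor. Qed.
Fact padd0 : left_id (qcl 0) padd.
Proof. by elim/qpcl_ind=> ?; rewrite !pE; apply/qpclP; constructor. Qed.
Fact paddN : left_inverse (qcl 0) popp padd.
Proof. by elim/qpcl_ind=> ?; rewrite !pE; apply/qpclP; constructor. Qed.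

HB.instance Definition _ :=
  GRing.isZmodule.Build pquot paddA paddC padd0 paddN.

Fact pmulA : associative pmul.
Proof. by do 3!elim/qpcl_ind=> ?; rewrite !pE; apply/qpclP; constructor. Qed.
Fact pmul1l : left_id (qcl 1) pmul.
Proof. by elim/qpcl_ind=> ?; rewrite !pE; apply/qpclP; constructor. Qed.
Fact pmul1r : right_id (qcl 1) pmul.
Proof. by elim/qpcl_ind=> ?; rewrite !pE; apply/qpclP; constructor. Qed.
Fact pmulDl : left_distributive pmul padd.
Proof. by do 3!elim/qpcl_ind=> ?; rewrite !pE; apply/qpclP; constructor. Qed.
Fact pmulDr : right_distributive pmul padd.
Proof. by do 3!elim/qpcl_ind=> ?; rewrite !pE; apply/qpclP; constructor. Qed.

HB.instance Definition _ :=
  GRing.Zmodule_isPzRing.Build pquot pmulA pmul1l pmul1r pmulDl pmulDr.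

Fact pscaleA k l a : pscale k (pscale l a) = pscale (k * l) a.
Proof. by elim/qpcl_ind: a => ?; rewrite !pE; apply/qpclP; constructor. Qed.
Fact pscale1 : left_id 1 pscale.
Proof. by elim/qpcl_ind=> ?; rewrite !pE; apply/qpclP; constructor. Qed.
Fact pscaleDr : right_distributive pscale padd.
Proof.
by move=> k; do 2!elim/qpcl_ind=> ?; rewrite !pE; apply/qpclP; constructor.
Qed.
Fact pscaleDl a : {morph pscale^~ a : k l / k + l >-> padd k l}.
Proof.
by move=> k l; elim/qpcl_ind: a => ?; rewrite !pE; apply/qpclP; constructor.
Qed.

Fact pscaleAl k (a b : pquot) : pscale k (a * b) = pscale k a * b.
Proof.
by elim/qpcl_ind: a => ?; elim/qpcl_ind: b => ?; rewrite /GRing.mul /= !pE;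
  apply/qpclP; constructor.
Qed.
Fact pscaleAr k (a b : pquot) : pscale k (a * b) = a * pscale k b.
Proof.
by elim/qpcl_ind: a => ?; elim/qpcl_ind: b => ?; rewrite /GRing.mul /= !pE;
  apply/qpclP; constructor.
Qed.

Definition presalg : pzAlgType K :=
  PzAlgType pscaleA pscale1 pscaleDr pscaleDl pscaleAl pscaleAr.

End PresentedAlgebra.

Section PresentedAlgebraTheory.
Context (K : pzRingType) (X : Type).
Context (rel : fterm K X -> fterm K X -> Prop).
Local Notation presalg := (presalg rel).

Definition pcl (t : fterm K X) : presalg := \pi_(pquot rel) t.
Definition prepr (a : presalg) : fterm K X := @repr _ (pquot rel) a.

Lemma pclP s t : pcl s = pcl t <-> fcong rel s t.
Proof. exact: qpclP. Qed.

Lemma pcl_repr (a : presalg) : pcl (prepr a) = a.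
Proof. exact: reprK. Qed.

Lemma pcl_ind (P : presalg -> Prop) : (forall t, P (pcl t)) -> forall a, P a.
Proof. by move=> h a; rewrite -(pcl_repr a). Qed.

Lemma repr_pcl t : fcong rel (prepr (pcl t)) t.
Proof. by apply/pclP; rewrite pcl_repr. Qed.

Definition pgen (x : X) : presalg := pcl (FGen x).

Lemma pcl0 : pcl 0 = 0. Proof. by []. Qed.
Lemma pcl1 : pcl 1 = 1. Proof. by []. Qed.
Lemma pclD s t : pcl (s + t) = pcl s + pcl t.
Proof. by symmetry; exact: paddE. Qed.
Lemma pclN s : pcl (- s) = - pcl s.
Proof. by symmetry; exact: poppE. Qed.
Lemma pclM s t : pcl (s * t) = pcl s * pcl t.
Proof. by symmetry; exact: pmulE. Qed.
Lemma pclZ k s : pcl (k *: s) = k *: pcl s.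
Proof. by symmetry; exact: pscaleE. Qed.
Definition pclE := (pcl0, pcl1, pclD, pclN, pclM, pclZ).

Lemma pcl_rel s t : rel s t -> pcl s = pcl t.
Proof. by move=> h; apply/pclP; apply: FCrel. Qed.

Lemma pcl_sum (I : Type) (s : seq I) (F : I -> fterm K X) :
  pcl (\big[@FAdd K X/0%T]_(i <- s) F i) = \sum_(i <- s) pcl (F i).
Proof.
by elim: s => [|i s IH]; rewrite ?big_nil // !big_cons pclD IH.
Qed.

End PresentedAlgebraTheory.

Section Lift.
Context (K : pzRingType) (X : Type).
Context (rel : fterm K X -> fterm K X -> Prop).
Context (A : pzAlgType K) (f : X -> A).

Fixpoint feval (t : fterm K X) : A :=
  match t with
  | FGen x => f x
  | FZero => 0
  | FOne => 1
  | FAdd s t => feval s + feval t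
  | FOpp s => - feval s
  | FMul s t => feval s * feval t
  | FScale k s => k *: feval s
  end.

Definition plift (a : presalg rel) : A := feval (prepr a).

Hypothesis fP : forall s t, rel s t -> feval s = feval t.

Lemma feval_cong s t : fcong rel s t -> feval s = feval t.
Proof.
elim=> //=.
- by move=> ? ? ? _ -> _ ->.
- by move=> ? ? ? ? _ -> _ ->.
- by move=> ? ? _ ->.
- by move=> ? ? ? ? _ -> _ ->.
- by move=> ? ? ? _ ->.
- by move=> *; rewrite addrA.
- by move=> *; rewrite addrC.
- by move=> *; rewrite add0r.
- by move=> *; rewrite addNr.
- by move=> *; rewrite mulrA.
- by move=> *; rewrite mul1r.
- by move=> *; rewrite mulr1.
- by move=> *; rewrite mulrDl.
- by move=> *; rewrite mulrDr.
- by move=> *; rewrite scalerA.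
- by move=> *; rewrite scale1r.
- by move=> *; rewrite scalerDr.
- by move=> *; rewrite scalerDl.
- by move=> *; rewrite pzscalerAl.
- by move=> *; rewrite pzscalerAr.
Qed.

Lemma plift_cl t : plift (pcl rel t) = feval t.
Proof. by apply: feval_cong; apply: repr_pcl. Qed.

Lemma plift_gen x : plift (pgen rel x) = f x.
Proof. exact: plift_cl. Qed.

Lemma plift1 : plift 1 = 1.
Proof. exact: plift_cl. Qed.

Lemma pliftP k : {morph plift : a b / k *: a + b}.
Proof.
by elim/pcl_ind=> s; elim/pcl_ind=> t; rewrite -pclZ -pclD !plift_cl.
Qed.

Lemma pliftM : {morph plift : a b / a * b}.
Proof.
by elim/pcl_ind=> s; elim/pcl_ind=> t; rewrite -pclM !plift_cl.
Qed.

End Lift.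

Lemma presalg_gen_ind (K : pzRingType) (X : Type)
    (rel : fterm K X -> fterm K X -> Prop) (P : presalg rel -> Prop) :
  (forall x, P (pgen rel x)) -> P 0 -> P 1 ->
  (forall a b, P a -> P b -> P (a + b)) ->
  (forall a b, P a -> P b -> P (a * b)) ->
  (forall k a, P a -> P (k *: a)) -> forall a, P a.
Proof.
move=> Pg P0 P1 PD PM PZ; elim/pcl_ind; elim=> //.
- by move=> s Ps t Pt; rewrite pclD; apply: PD.
- by move=> s Ps; rewrite pclN -scaleN1r; apply: PZ.
- by move=> s Ps t Pt; rewrite pclM; apply: PM.
- by move=> k s Ps; rewrite pclZ; apply: PZ.
Qed.

(** A Z/2-grading [A = A_0 + A_1] of an algebra over a field of characteristic
    different from 2 is encoded by its parity automorphism, which is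
    [(-1) ^+ b] on [A_b]. *)

Record superAlg (K : numFieldType) := SuperAlg {
  sa_sort :> pzAlgType K;
  parity : sa_sort -> sa_sort;
  parityP : forall k, {morph parity : a b / k *: a + b};
  parity1 : parity 1 = 1;
  parityM : {morph parity : a b / a * b};
  parityK : involutive parity
}.

Section Super.
Context (K : numFieldType) (A : superAlg K).
Implicit Types a b : A.

Definition homog (p : bool) : set A := [set a | parity a = (-1) ^+ p *: a].

Definition hpart (p : bool) a : A := 2^-1 *: (a + (-1) ^+ p *: parity a).

Definition scomm a b : A :=
  \sum_(p : bool) \sum_(q : bool)
    (hpart p a * hpart q b - (-1) ^+ (p && q) *: (hpart q b * hpart p a)).

Lemma hpart_homog p a : homog p (hpart p a).
Proof.
rewrite /homog /hpart /=.
have pD x y : parity (x + y) = parity x + parity y :> A.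
  by rewrite -[x]scale1r parityP !scale1r.
have p0 : parity 0 = 0 :> A.
  by apply: (addIr (parity (0 : A))); rewrite -pD !add0r.
have pZ k x : parity (k *: x) = k *: parity x :> A.
  by rewrite -[k *: x]addr0 parityP p0 addr0.
rewrite pZ pD pZ parityK scalerA [_ * 2^-1]mulrC -scalerA; congr (_ *: _).
by rewrite addrC scalerDr scalerA -expr2 sqrr_sign scale1r.
Qed.

Lemma hpart_sum a : a = hpart false a + hpart true a.
Proof.
rewrite /hpart -scalerDr expr0 expr1 scale1r scaleN1r addrACA subrr addr0.
by rewrite -mulr2n -scaler_nat scalerA mulVf ?scale1r // pnatr_eq0.
Qed.

Lemma homogM p q a b : homog p a -> homog q b -> homog (p (+) q) (a * b).
Proof.
rewrite /homog /= parityM => -> ->.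
by rewrite -pzscalerAl -pzscalerAr scalerA -signr_addb.
Qed.

Lemma hpart_id p q a : homog p a -> hpart q a = if p == q then a else 0.
Proof.
rewrite /homog /hpart /= => ->; rewrite scalerA -signr_addb.
case: p; case: q; rewrite /= ?expr0 ?expr1 ?scale1r ?scaleN1r ?subrr ?scaler0 //;
by rewrite -mulr2n -scaler_nat scalerA mulVf ?scale1r // pnatr_eq0.
Qed.

Lemma scomm_homog p q a b : homog p a -> homog q b ->
  scomm a b = a * b - (-1) ^+ (p && q) *: (b * a).
Proof.
move=> ha hb; rewrite /scomm.
rewrite (bigD1 p) //= [X in _ + X]big1 ?addr0; last first.
  move=> p' np; apply: big1 => q' _.
  by rewrite (hpart_id p' ha) eq_sym (negPf np) mul0r mulr0 scaler0 subrr.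
rewrite (bigD1 q) //= [X in _ + X]big1 ?addr0; last first.
  move=> q' nq.
  by rewrite (hpart_id q' hb) eq_sym (negPf nq) mul0r mulr0 scaler0 subrr.
by rewrite (hpart_id p ha) (hpart_id q hb) !eqxx.
Qed.

End Super.

(** [L] is a subset of an ambient module [V] carrying homogeneous components
    [hom] and an operation [br]; the structure on [L] is the restricted one. *)

Definition subspace (K : pzRingType) (V : lmodType K) (L : set V) : Prop :=
  L 0 /\ forall k u v, L u -> L v -> L (k *: u + v).

Definition lin_span (K : pzRingType) (V : lmodType K) (s : seq V) : set V :=
  [set v | exists k : 'I_(size s) -> K, v = \sum_i k i *: s`_i].

Definition lie_superalgebra (K : pzRingType) (V : lmodType K)
    (hom : bool -> set V) (br : V -> V -> V) (L : set V) : Prop :=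
  let Lh p := [set u : V | L u /\ hom p u] in
  [/\ subspace L,
      (forall p, subspace (Lh p)),
      (forall u, L u -> exists! w : V * V,
         [/\ Lh false w.1, Lh true w.2 & u = w.1 + w.2]),
      (forall k u v w, L u -> L v -> L w ->
         br (k *: u + v) w = k *: br u w + br v w /\
         br w (k *: u + v) = k *: br w u + br w v) &
      [/\ (forall u v, L u -> L v -> L (br u v)),
          (forall p q u v, Lh p u -> Lh q v -> Lh (p (+) q) (br u v)),
          (forall p q u v, Lh p u -> Lh q v ->
             br u v = - ((-1) ^+ (p && q) *: br v u)) &
          (forall p q u v w, Lh p u -> Lh q v -> L w ->
             br u (br v w) =
             br (br u v) w + (-1) ^+ (p && q) *: br v (br u w))]].

Definition lie_superalgebra_iso (K : pzRingType) (V V' : lmodType K)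
    (hom : bool -> set V) (br : V -> V -> V) (L : set V)
    (hom' : bool -> set V') (br' : V' -> V' -> V') (L' : set V') : Prop :=
  exists f : V -> V',
    [/\ (forall u, L u -> L' (f u)),
        (forall u v, L u -> L v -> f u = f v -> u = v),
        (forall u', L' u' -> exists2 u, L u & f u = u') &
        [/\ (forall k u v, L u -> L v -> f (k *: u + v) = k *: f u + f v),
            (forall p u, L u -> hom p u -> hom' p (f u)) &
            (forall u v, L u -> L v -> f (br u v) = br' (f u) (f v))]].

Section Matrices.
Context (K : numFieldType) (m n : nat).

Definition mx_parity (M : 'M[K]_(m + n)) : 'M[K]_(m + n) :=
  block_mx (ulsubmx M) (- ursubmx M) (- dlsubmx M) (drsubmx M).

Fact mx_parityP k : {morph mx_parity : a b / k *: a + b}.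
Proof.
move=> a b; rewrite /mx_parity scale_block_mx add_block_mx.
by congr block_mx; apply/matrixP => i j; rewrite !mxE // mulrN opprD.
Qed.

Fact mx_parity1 : mx_parity 1 = 1.
Proof.
have -> : 1 = 1%:M :> 'M[K]_(m + n) by [].
rewrite /mx_parity (scalar_mx_block m n).
by rewrite block_mxKul block_mxKur block_mxKdl block_mxKdr !oppr0.
Qed.

Fact mx_parityM : {morph mx_parity : a b / a * b}.
Proof.
have mulE (a b : 'M[K]_(m + n)) : a * b = a *m b by [].
move=> a b; rewrite !mulE -[a]submxK -[b]submxK /mx_parity.
rewrite !(mulmx_block, block_mxKul, block_mxKur, block_mxKdl, block_mxKdr).
by congr block_mx; rewrite ?mulmxN ?mulNmx ?opprK ?opprD.
Qed.

Fact mx_parityK : involutive mx_parity.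
Proof.
move=> a; rewrite {1}/mx_parity /mx_parity.
by rewrite block_mxKul block_mxKur block_mxKdl block_mxKdr !opprK submxK.
Qed.

Definition mx_super : superAlg K :=
  @SuperAlg K (mx_alg K (m + n)) mx_parity
    mx_parityP mx_parity1 mx_parityM mx_parityK.

Let oppr_id (p q : nat) (N : 'M[K]_(p, q)) : - N = N -> N = 0.
Proof.
move/eqP; rewrite eq_sym -subr_eq0 opprK -mulr2n -scaler_nat => /eqP h.
have -> : N = 2^-1 *: (2%:R *: N) by rewrite scalerA mulVf ?scale1r ?pnatr_eq0.
by rewrite h scaler0.
Qed.

Lemma mx_even_block (M : mx_super) :
  homog false M <->
  exists (a : 'M[K]_m) (d : 'M[K]_n), M = block_mx a 0 0 d.
Proof.
rewrite /homog /= expr0 scale1r; split=> [e | [a [d ->]]]; last first.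
  rewrite /mx_parity block_mxKul block_mxKur block_mxKdl block_mxKdr.
  by rewrite !oppr0.
have eur : - ursubmx (M : 'M_(m + n)) = ursubmx (M : 'M_(m + n)).
  by rewrite -[in RHS]e block_mxKur.
have edl : - dlsubmx (M : 'M_(m + n)) = dlsubmx (M : 'M_(m + n)).
  by rewrite -[in RHS]e block_mxKdl.
exists (ulsubmx (M : 'M_(m + n))), (drsubmx (M : 'M_(m + n))).
by rewrite -[LHS](@submxK K m n m n) (oppr_id eur) (oppr_id edl).
Qed.

Lemma mx_odd_block (M : mx_super) :
  homog true M <->
  exists (b : 'M[K]_(m, n)) (c : 'M[K]_(n, m)), M = block_mx 0 b c 0.
Proof.
rewrite /homog /= expr1 scaleN1r; split=> [e | [b [c ->]]]; last first.
  rewrite /mx_parity block_mxKul block_mxKur block_mxKdl block_mxKdr.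
  by rewrite [RHS](@opp_block_mx _ m n m n 0 b c 0) !oppr0.
have e' : mx_parity M = - (M : 'M_(m + n)) by [].
have eul : - ulsubmx (M : 'M_(m + n)) = ulsubmx (M : 'M_(m + n)).
  apply/matrixP => i j; have := congr1 (fun N => ulsubmx N i j) e'.
  by rewrite /= block_mxKul !mxE => <-.
have edr : - drsubmx (M : 'M_(m + n)) = drsubmx (M : 'M_(m + n)).
  apply/matrixP => i j; have := congr1 (fun N => drsubmx N i j) e'.
  by rewrite /= block_mxKdr !mxE => <-.
exists (ursubmx (M : 'M_(m + n))), (dlsubmx (M : 'M_(m + n))).
by rewrite -[LHS](@submxK K m n m n) (oppr_id eul) (oppr_id edr).
Qed.

End Matrices.

Definition spo22 (K : numFieldType) : set (mx_super K 2 2) :=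
  [set M | exists a b c d x y u v : K,
    M = \matrix_(i < 4, j < 4)
      (nth [::] [:: [:: a; b; y; u];
                    [:: c; - a; - v; - x];
                    [:: x; u; d; 0];
                    [:: v; y; 0; - d]] i)`_j].

(** [A (x) B] is generated by the symbols [a (x) b], which are bilinear in
    [(a, b)] and satisfy [(a (x) u) * (b (x) v) = ab (x) uv]; this rule makes
    the subspace they span an algebra. *)

Inductive tens_rel (K : pzRingType) (A B : pzAlgType K) :
    fterm K (A * B) -> fterm K (A * B) -> Prop :=
| TRl k a a' u :
    tens_rel (FGen (k *: a + a', u)) (k *: FGen (a, u) + FGen (a', u))
| TRr k a u u' :
    tens_rel (FGen (a, k *: u + u')) (k *: FGen (a, u) + FGen (a, u'))
| TRM a b u v :
    tens_rel (FGen (a, u) * FGen (b, v)) (FGen (a * b, u * v)%R)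
| TR1 : tens_rel 1 (FGen (1, 1)%R).

Definition tensor (K : pzRingType) (A B : pzAlgType K) : pzAlgType K :=
  presalg (@tens_rel K A B).

Definition tens (K : pzRingType) (A B : pzAlgType K) (a : A) (u : B) :
  tensor A B := pgen (@tens_rel K A B) (a, u).
Notation "a ⊗ u" := (tens a u) (at level 40, left associativity) : ring_scope.

Section TensorTheory.
Context (K : pzRingType) (A B : pzAlgType K).
Implicit Types (a b : A) (u v : B).

Lemma tensPl k a a' u : (k *: a + a') ⊗ u = k *: (a ⊗ u) + a' ⊗ u.
Proof. by rewrite /tens /pgen -pclZ -pclD; apply: pcl_rel; constructor. Qed.
Lemma tensPr k a u u' : a ⊗ (k *: u + u') = k *: (a ⊗ u) + a ⊗ u'.
Proof. by rewrite /tens /pgen -pclZ -pclD; apply: pcl_rel; constructor. Qed.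
Lemma tensM a b u v : (a ⊗ u) * (b ⊗ v) = (a * b) ⊗ (u * v).
Proof. by rewrite /tens /pgen -pclM; apply: pcl_rel; constructor. Qed.
Lemma tens1 : 1 ⊗ 1 = 1 :> tensor A B.
Proof. by rewrite /tens /pgen -pcl1; symmetry; apply: pcl_rel; constructor. Qed.

End TensorTheory.

(** Here [A] is purely even: the parity is that of the [B]-factor. *)
Section TensorSuper.
Context (K : numFieldType) (A : pzAlgType K) (B : superAlg K).

Definition tens_parity : tensor A B -> tensor A B :=
  plift (fun g : A * B => g.1 ⊗ parity g.2).

Fact tens_parity_rel s t : @tens_rel K A B s t ->
  feval (fun g : A * B => g.1 ⊗ parity g.2 : tensor A B) s
  = feval (fun g : A * B => g.1 ⊗ parity g.2 : tensor A B) t.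
Proof.
case=> /=; first by move=> *; rewrite tensPl.
- by move=> *; rewrite parityP tensPr.
- by move=> *; rewrite parityM tensM.
- by rewrite parity1 tens1.
Qed.

Lemma tens_parityE a u : tens_parity (a ⊗ u) = a ⊗ parity u.
Proof. exact: (plift_gen tens_parity_rel (a, u)). Qed.

Fact tens_parityP k : {morph tens_parity : a b / k *: a + b}.
Proof. exact: (pliftP tens_parity_rel). Qed.
Fact tens_parity1 : tens_parity 1 = 1.
Proof. exact: (plift1 tens_parity_rel). Qed.
Fact tens_parityM : {morph tens_parity : a b / a * b}.
Proof. exact: (pliftM tens_parity_rel). Qed.

Fact tens_parityK : involutive tens_parity.
Proof.
have p0 : tens_parity 0 = 0.
  have := tens_parityP (-1) 0 0.
  by rewrite scaler0 addr0 scaleN1r addNr.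
elim/presalg_gen_ind.
- by case=> a u; rewrite -/(a ⊗ u) !tens_parityE parityK.
- by rewrite !p0.
- by rewrite !tens_parity1.
- move=> a b Ha Hb; rewrite -[a]scale1r tens_parityP tens_parityP.
  by rewrite Ha Hb.
- by move=> a b Ha Hb; rewrite !tens_parityM Ha Hb.
- by move=> k a Ha; rewrite -[_ *: _]addr0 !tens_parityP !p0 Ha.
Qed.

Definition tensor_super : superAlg K :=
  SuperAlg tens_parityP tens_parity1 tens_parityM tens_parityK.

Lemma tens_homog p a (u : B) : homog p u -> @homog K tensor_super p (a ⊗ u).
Proof.
rewrite /homog /= tens_parityE => ->.
have tZ k v : a ⊗ (k *: v) = k *: (a ⊗ v) :> tensor A B.
  have := @tensPr K A B (-1) a v v; rewrite !scaleN1r !addNr => t0.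
  by rewrite -[k *: v]addr0 tensPr t0 addr0.
exact: tZ.
Qed.

End TensorSuper.

(** [E] is the space ['cV[R]_r] with the inner product of Gram matrix [G].
    Elements of [E^*] are represented by vectors through the identification
    of [E^*] with [E], so that the pairing of [E^*] and [E] is [inner G].
    Elements of the complexifications [h] and [h^*] are represented in the
    same way in ['cV[R[i]]_r], with pairing [cpair G]; as [W] preserves the
    inner product, its action on [h^*] is given by the same matrices. *)

Section Reflections.
Context (R : realType) (r : nat) (G : 'M[R]_r).
Implicit Types (a u v : 'cV[R]_r) (Phi : {fset 'cV[R]_r}).

Definition inner u v : R := (u^T *m G *m v) 0 0.

Definition inner_product : Prop :=
  G^T = G /\ forall v, v != 0 -> 0 < inner v v.

Definition coroot a : 'cV[R]_r := (2 / inner a a) *: a.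

Definition refl a : 'M[R]_r := 1%:M - coroot a *m (a^T *m G).

Lemma reflE a v : refl a *m v = v - inner a v *: coroot a.
Proof.
rewrite /refl mulmxBl mul1mx -mulmxA; congr (_ - _).
by rewrite [a^T *m G *m v]mx11_scalar -/(inner a v) mul_mx_scalar.
Qed.

Definition root_system Phi : Prop :=
  [/\ 0 \notin Phi,
      (forall a b, a \in Phi -> b \in Phi -> refl a *m b \in Phi) &
      (forall a (k : R), a \in Phi -> k *: a \in Phi -> k = 1 \/ k = - 1)].

Definition positive_roots Phi (Phip : {fset 'cV[R]_r}) : Prop :=
  exists t : 'cV[R]_r,
    (forall a, a \in Phi -> inner a t != 0) /\
    (forall a, (a \in Phip) = (a \in Phi) && (0 < inner a t)).

Inductive refl_group Phi : set 'M[R]_r :=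
| RG1 : refl_group Phi 1%:M
| RGrefl a : a \in Phi -> refl_group Phi (refl a)
| RGM w w' : refl_group Phi w -> refl_group Phi w' -> refl_group Phi (w *m w')
| RGV w : refl_group Phi w -> refl_group Phi (invmx w).

Definition reflW Phi : Type := {w : 'M[R]_r | w \in refl_group Phi}.
HB.instance Definition _ Phi := SubType.on (reflW Phi).
HB.instance Definition _ Phi := Equality.on (reflW Phi).

Definition oneW Phi : reflW Phi := exist _ 1%:M (mem_set (RG1 Phi)).

(** [insubd] has the default value [oneW Phi], not used for [a \in Phi]. *)
Definition sW Phi a : reflW Phi := insubd (oneW Phi) (refl a).

Lemma val_sW Phi a : a \in Phi -> val (sW Phi a) = refl a.
Proof. by move=> aP; rewrite insubdK //; apply: mem_set; apply: RGrefl. Qed.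

Definition W_invariant Phi (c : 'cV[R]_r -> R[i]) : Prop :=
  forall w a, refl_group Phi w -> a \in Phi -> c (w *m a) = c a.

Definition cplx (m n : nat) (M : 'M[R]_(m, n)) : 'M[R[i]]_(m, n) :=
  map_mx (real_complex R) M.

Definition cpair (x y : 'cV[R[i]]_r) : R[i] := (x^T *m cplx G *m y) 0 0.

(** [h + h^*], with first component in [h] and second in [h^*]. *)
Definition hh : Type := 'cV[R[i]]_r * 'cV[R[i]]_r.

Definition in_h (y : 'cV[R[i]]_r) : hh := (y, 0).
Definition in_hd (x : 'cV[R[i]]_r) : hh := (0, x).

End Reflections.

Arguments in_h {R r}.
Arguments in_hd {R r}.

Section Cherednik.
Context (R : realType) (r : nat) (G : 'M[R]_r).
Context (Phi Phip : {fset 'cV[R]_r}) (c : 'cV[R]_r -> R[i]).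

Let term := fterm R[i] (hh R r + reflW G Phi).
Let V (v : hh R r) : term := FGen (inl v).
Let W (w : reflW G Phi) : term := FGen (inr w).

(** The first four relations present the smash product of the tensor algebra
    of [h + h^*] with [W]. *)
Inductive cherednik_rel : term -> term -> Prop :=
| CRlin k u v : cherednik_rel (V (k *: u + v)) (k *: V u + V v)%T
| CRW1 : cherednik_rel (W (oneW G Phi)) 1%T
| CRWM w1 w2 w : val w = val w1 *m val w2 ->
    cherednik_rel (W w1 * W w2)%T (W w)
| CRact w y x :
    cherednik_rel (W w * V (y, x))%T
      (V (cplx (val w) *m y, cplx (val w) *m x) * W w)%T
| CRyy y y' :
    cherednik_rel (V (in_h y) * V (in_h y') - V (in_h y') * V (in_h y))%T 0%T
| CRxx x x' :
    cherednik_rel (V (in_hd x) * V (in_hd x') - V (in_hd x') * V (in_hd x))%T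
                  0%T
| CRyx y x :
    cherednik_rel
      (V (in_h y) * V (in_hd x) - V (in_hd x) * V (in_h y))%T
      (cpair G x y *: 1 -
       \big[@FAdd _ _/0]_(a <- Phip)
         ((c a * cpair G (cplx a) y * cpair G x (cplx (coroot G a)))
            *: W (sW G Phi a)))%T.

Definition cherednik : pzAlgType R[i] := presalg cherednik_rel.

Definition Hv (v : hh R r) : cherednik := pgen cherednik_rel (inl v).
Definition Hw (w : reflW G Phi) : cherednik := pgen cherednik_rel (inr w).

Lemma Hyx y x :
  Hv (in_h y) * Hv (in_hd x) - Hv (in_hd x) * Hv (in_h y) =
  cpair G x y *: (1 : cherednik) -
  \sum_(a <- Phip) (c a * cpair G (cplx a) y * cpair G x (cplx (coroot G a)))
     *: Hw (sW G Phi a).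
Proof.
have := pcl_rel (CRyx y x); rewrite !pclE pcl_sum => ->.
by congr (_ - _); apply: eq_bigr => a _; rewrite pclE.
Qed.

End Cherednik.

Section Clifford.
Context (R : realType) (r : nat) (G : 'M[R]_r).

Definition cliffB (v v' : hh R r) : R[i] :=
  cpair G v.2 v'.1 + cpair G v'.2 v.1.

Inductive clifford_rel : fterm R[i] (hh R r) -> fterm R[i] (hh R r) -> Prop :=
| KRlin k u v :
    clifford_rel (FGen (k *: u + v)) (k *: FGen u + FGen v)
| KRB v v' :
    clifford_rel (FGen v * FGen v' + FGen v' * FGen v) (cliffB v v' *: 1).

Definition clifford_alg : pzAlgType R[i] := presalg clifford_rel.

Definition cliff_parity : clifford_alg -> clifford_alg :=
  plift (fun v => - pgen clifford_rel v).

Fact cliff_parity_rel s t : clifford_rel s t ->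
  feval (fun v => - pgen clifford_rel v : clifford_alg) s
  = feval (fun v => - pgen clifford_rel v : clifford_alg) t.
Proof.
case=> [k u v|v v'] /=.
  by rewrite /pgen (pcl_rel (KRlin k u v)) !pclE scalerN opprD.
by rewrite !mulrNN /pgen -!pclM -pclD (pcl_rel (KRB v v')) !pclE.
Qed.

Lemma cliff_parity_gen v :
  cliff_parity (pgen clifford_rel v) = - pgen clifford_rel v.
Proof. exact: (plift_gen cliff_parity_rel). Qed.

Fact cliff_parityP k : {morph cliff_parity : a b / k *: a + b}.
Proof. exact: (pliftP cliff_parity_rel). Qed.
Fact cliff_parity1 : cliff_parity 1 = 1.
Proof. exact: (plift1 cliff_parity_rel). Qed.
Fact cliff_parityM : {morph cliff_parity : a b / a * b}.
Proof. exact: (pliftM cliff_parity_rel). Qed.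

Fact cliff_parityK : involutive cliff_parity.
Proof.
have p0 : cliff_parity 0 = 0.
  have := cliff_parityP (-1) 0 0.
  by rewrite scaler0 addr0 scaleN1r addNr.
have pZ k a : cliff_parity (k *: a) = k *: cliff_parity a.
  by rewrite -[k *: a]addr0 cliff_parityP p0 addr0.
elim/presalg_gen_ind.
- move=> v; rewrite cliff_parity_gen -scaleN1r pZ cliff_parity_gen.
  by rewrite !scaleN1r opprK.
- by rewrite !p0.
- by rewrite !cliff_parity1.
- move=> a b Ha Hb; rewrite -[a]scale1r cliff_parityP cliff_parityP.
  by rewrite Ha Hb.
- by move=> a b Ha Hb; rewrite !cliff_parityM Ha Hb.
- by move=> k a Ha; rewrite !pZ Ha.
Qed.

Definition clifford : superAlg R[i] :=
  SuperAlg cliff_parityP cliff_parity1 cliff_parityM cliff_parityK.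

Definition Cv (v : hh R r) : clifford := pgen clifford_rel v.

Lemma Cv_odd v : homog true (Cv v).
Proof. by rewrite /homog /= expr1 scaleN1r; apply: cliff_parity_gen. Qed.

Definition tau (a : 'cV[R]_r) : clifford :=
  1 - Cv (in_hd (cplx a)) * Cv (in_h (cplx (coroot G a))).

End Clifford.

Section Elements.
Context (R : realType) (r : nat) (G : 'M[R]_r).
Context (Phi Phip : {fset 'cV[R]_r}) (c : 'cV[R]_r -> R[i]).

Definition HC : superAlg R[i] :=
  tensor_super (cherednik G Phi Phip c) (clifford G).

Definition Omega : HC :=
  \sum_(a <- Phip) c a *: (Hw Phip c (sW G Phi a) ⊗ tau G a).

Context (y x : 'I_r -> 'cV[R]_r).

Let Hy i : cherednik G Phi Phip c := Hv G Phi Phip c (in_h (cplx (y i))).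
Let Hx i : cherednik G Phi Phip c := Hv G Phi Phip c (in_hd (cplx (x i))).
Let Cy i : clifford G := Cv G (in_h (cplx (y i))).
Let Cx i : clifford G := Cv G (in_hd (cplx (x i))).

Definition elH : HC := (\sum_i 2^-1 *: (Hx i * Hy i + Hy i * Hx i)) ⊗ 1.
Definition elZ : HC :=
  \sum_i 1 ⊗ (2^-1 *: (Cx i * Cy i - Cy i * Cx i)) + Omega.
Definition elE1p : HC := - ((\sum_i 2^-1 *: Hx i ^+ 2) ⊗ 1).
Definition elE1m : HC := (\sum_i 2^-1 *: Hy i ^+ 2) ⊗ 1.
Definition elE2p : HC := \sum_i Hy i ⊗ Cx i.
Definition elE2m : HC := \sum_i Hx i ⊗ Cy i.
Definition elE3p : HC := - \sum_i Hx i ⊗ Cx i.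
Definition elE3m : HC := - \sum_i Hy i ⊗ Cy i.

Definition g_span : set HC :=
  lin_span [:: elH; elZ; elE1p; elE1m; elE2p; elE2m; elE3p; elE3m].

Definition orthonormal_family : Prop := forall i j, inner G (y i) (y j) = (i == j)%:R.
Definition dual_basis : Prop := forall i j, inner G (x i) (y j) = (i == j)%:R.

End Elements.

Arguments g_span {R r} G Phi Phip c y x.

(* Main.v *)
From HB Require Import structures.
Require Import Defs.
From mathcomp Require Import all_boot all_order all_algebra.
From mathcomp Require Import finmap boolp classical_sets functions reals.
From mathcomp.real_closed Require Import complex.
From mathcomp Require Import ring.

Import Order.TTheory GRing.Theory Num.Theory.
Local Open Scope ring_scope.
Local Open Scope complex_scope.
Set Implicit Arguments.
Unset Strict Implicit.
Unset Printing Implicit Defensive.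

(** The proof has two halves: the eight elements have the structure constants of
    a basis of spo(2|2), and they are linearly independent.

    Structure constants. Write [h, z, e, f, p, m, p', m'] for
    [H, Z, E_1^+, E_1^-, E_2^+, E_2^-, E_3^+, E_3^-]. By the super Jacobi
    identity ([scomm_jacobi]) all brackets follow from those of the odd elements
    and from [[e, p] = - p'], [[f, p'] = - p], [[f, m] = - m'], [[e, m'] = - m]:
    for example [h + z = [p, m]] and [[p, p] = 0] give [[h + z, p] = 0]
    ([spo_rel], [spo_tableP]). The four mixed brackets amount to
    [[y, sum_i x_i^2] = 2 x_y] and its analogue for [sum_i y_i^2], where the
    reflection terms cancel in pairs ([Hgy_sum_sqr], [sum_sqr_Hgx]). In the
    brackets of odd elements, each commutator [[y_i, x_j]] contributes reflection
    terms that sum up to [s_a (x) alpha alpha^v] and account for [Omega_c]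
    ([scomm_tens_yx], [cherednik_spo_rel]). The same relations hold for eight
    matrices that span spo(2|2) ([spo_mx_rel]).

    Independence. An eigenvalue argument for [ad h] and [ad z] shows that it is
    enough that [e] is not zero ([spo_free]). Since [e] is
    [- (sum_i x_i^2) / 2 (x) 1], a module over the tensor product on which it acts
    non-trivially is needed. The Cherednik algebra acts on the symmetric algebra
    of [h^*], the vectors [y] acting by Dunkl operators. Such an operator [T_y] is
    determined by [T_y 1 = 0] and by its commutators with the multiplications; it
    exists because these two conditions define a representation of the symmetric
    algebra on two copies of itself, off which [T_y] is read
    ([twisted_derivation]). Two Dunkl operators commute because their commutator
    kills 1 and commutes with the multiplications ([dunklC]). With the exterior
    algebra and contractions instead, the same construction represents the
    Clifford algebra and yields a linear functional on it that takes the value 1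
    at 1 ([clifford_functional]). The tensor product then acts on the linear maps
    [F] from the Clifford algebra to the symmetric algebra by
    [((a (x) w) F) (u) = a F(u w)], and [sum_i x_i^2 (x) 1] does not act by zero
    ([tens1_neq0], [elE1p_neq0]). *)

(** Closes an identity between signed sums in an abelian group whose terms
    cancel in pairs. *)
Ltac cancel_opp :=
  apply/eqP; rewrite -subr_eq0; apply/eqP; rewrite ?opprD ?opprK -?addrA;
  match goal with |- ?s = 0 => rewrite -(addr0 s) -?addrA end;
  repeat (match goal with
  | |- - ?t + _ = 0 => do 20?[rewrite (addrCA _ t)]; rewrite ?addNKr ?addKr
  | |- ?t + _ = 0 => do 20?[rewrite (addrCA _ (- t))]; rewrite ?addNKr ?addKr
  end); try reflexivity.

(** * The supercommutator of a superalgebra *)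

Section SuperTheory.
Context (K : numFieldType) (A : superAlg K).
Implicit Types (a b c : A) (k : K) (p q : bool).

HB.instance Definition _ := GRing.isLinear.Build K A A *:%R (@parity K A)
  (fun k a b => parityP k a b).

Lemma hpart_is_linear p : linear (@hpart K A p).
Proof.
move=> k a b; rewrite /hpart linearP.
rewrite scalerA [k * _]mulrC -scalerA -scalerDr; congr (_ *: _).
by rewrite !scalerDr addrACA !scalerA [k * _]mulrC.
Qed.

HB.instance Definition _ p := GRing.isLinear.Build K A A *:%R (hpart p)
  (@hpart_is_linear p).

Lemma scommPl k a a' b : scomm (k *: a + a') b = k *: scomm a b + scomm a' b.
Proof.
rewrite /scomm !scaler_sumr -big_split; apply: eq_bigr => p _.
rewrite !scaler_sumr -big_split; apply: eq_bigr => q _ /=.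
rewrite !linearP /=; move: (hpart p a) (hpart p a') (hpart q b) => u u' v.
rewrite mulrDl mulrDr -pzscalerAl -pzscalerAr scalerBr scalerDr opprD.
by rewrite addrACA !scalerA [k * _]mulrC.
Qed.

Lemma scommPr k a b b' : scomm a (k *: b + b') = k *: scomm a b + scomm a b'.
Proof.
rewrite /scomm !scaler_sumr -big_split; apply: eq_bigr => p _.
rewrite !scaler_sumr -big_split; apply: eq_bigr => q _ /=.
rewrite !linearP /=; move: (hpart q b) (hpart q b') (hpart p a) => u u' v.
rewrite mulrDl mulrDr -pzscalerAl -pzscalerAr scalerBr scalerDr opprD.
by rewrite addrACA !scalerA [k * _]mulrC.
Qed.

HB.instance Definition _ a := GRing.isLinear.Build K A A *:%R (scomm a)
  (fun k b b' => scommPr k a b b').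

Lemma scommDl a a' b : scomm (a + a') b = scomm a b + scomm a' b.
Proof. by have := scommPl 1 a a' b; rewrite !scale1r. Qed.

Lemma scomm0l b : scomm 0 b = 0.
Proof. by apply: (addIr (scomm 0 b)); rewrite -scommDl !add0r. Qed.

Lemma scommZl k a b : scomm (k *: a) b = k *: scomm a b.
Proof. by rewrite -[k *: a]addr0 scommPl scomm0l addr0. Qed.

Lemma scommNl a b : scomm (- a) b = - scomm a b.
Proof. by rewrite -scaleN1r scommZl scaleN1r. Qed.

Lemma scomm_suml (I : Type) (r : seq I) (P : pred I) (F : I -> A) b :
  scomm (\sum_(i <- r | P i) F i) b = \sum_(i <- r | P i) scomm (F i) b.
Proof.
by apply: (big_morph (fun a => scomm a b)) => [a a'|];
  rewrite ?scommDl ?scomm0l.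
Qed.

Lemma scomm_sumr (I : Type) (r : seq I) (P : pred I) (F : I -> A) a :
  scomm a (\sum_(i <- r | P i) F i) = \sum_(i <- r | P i) scomm a (F i).
Proof. exact: linear_sum. Qed.

Lemma scommZr k a b : scomm a (k *: b) = k *: scomm a b.
Proof. exact: linearZ. Qed.

Lemma scommDr a b b' : scomm a (b + b') = scomm a b + scomm a b'.
Proof. exact: linearD. Qed.

Lemma scommNr a b : scomm a (- b) = - scomm a b.
Proof. exact: linearN. Qed.

Lemma scomm0r a : scomm a 0 = 0.
Proof. exact: linear0. Qed.

Lemma homogD p a b : homog p a -> homog p b -> homog p (a + b).
Proof. by rewrite /homog /= linearD /= scalerDr => -> ->. Qed.

Lemma homogZ p k a : homog p a -> homog p (k *: a).
Proof. by rewrite /homog /= linearZ /= => ->; rewrite !scalerA mulrC. Qed.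

Lemma homogN p a : homog p a -> homog p (- a).
Proof. by move=> ha; rewrite -scaleN1r; apply: homogZ. Qed.

Lemma homog_sum (I : Type) (r : seq I) (F : I -> A) p :
  (forall i, homog p (F i)) -> homog p (\sum_(i <- r) F i).
Proof.
move=> hF; rewrite /homog /= linear_sum scaler_sumr.
by apply: eq_bigr => i _; apply: hF.
Qed.

Lemma homog_scomm p q a b : homog p a -> homog q b ->
  homog (p (+) q) (scomm a b).
Proof.
move=> ha hb; rewrite (scomm_homog ha hb).
have hab := homogM ha hb; have := homogM hb ha; rewrite addbC.
move: hab; rewrite /homog /= => hab hba.
by rewrite linearB linearZ /= hab hba scalerBr !scalerA mulrC.
Qed.

Lemma scomm_anti p q a b : homog p a -> homog q b ->
  scomm a b = - ((-1) ^+ (p && q) *: scomm b a).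
Proof.
move=> ha hb; rewrite (scomm_homog ha hb) (scomm_homog hb ha) andbC.
by rewrite scalerBr scalerA -expr2 sqrr_sign scale1r opprB.
Qed.

(** The third argument need not be homogeneous: it is split into its
    homogeneous parts. *)
Lemma scomm_jacobi p q a b c : homog p a -> homog q b ->
  scomm a (scomm b c) =
  scomm (scomm a b) c + (-1) ^+ (p && q) *: scomm b (scomm a c).
Proof.
move=> ha hb.
have jac s c' : homog s c' -> scomm a (scomm b c') =
    scomm (scomm a b) c' + (-1) ^+ (p && q) *: scomm b (scomm a c').
  move=> hc; rewrite (scomm_homog ha (homog_scomm hb hc)).
  rewrite (scomm_homog (homog_scomm ha hb) hc).
  rewrite (scomm_homog hb (homog_scomm ha hc)).
  rewrite (scomm_homog ha hb) (scomm_homog ha hc) (scomm_homog hb hc).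
  case: p {ha} => //; case: q {hb} => //; case: s {hc} => //=;
  rewrite ?expr0 ?expr1 ?scale1r ?scaleN1r ?opprK ?mulrDr ?mulrDl ?mulrBr
    ?mulrBl ?mulrN ?mulNr ?opprD ?opprK ?mulrA ?opprD ?opprK; cancel_opp.
rewrite [c]hpart_sum !linearD /= addrACA.
by congr (_ + _); apply: jac (hpart_homog _ _).
Qed.

(** A subspace is a sub-Lie-superalgebra as soon as it is stable under the
    parity, hence graded, and under the supercommutator. *)
Lemma stable_lie_superalgebra (L : set A) :
  subspace L -> (forall a, L a -> L (parity a)) ->
  (forall a b, L a -> L b -> L (scomm a b)) ->
  lie_superalgebra (@homog K A) (@scomm K A) L.
Proof.
move=> [L0 LP] Lpar Lbr.
have LZ k a : L a -> L (k *: a) by move=> La; rewrite -[k *: a]addr0; apply: LP.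
have LD a b : L a -> L b -> L (a + b).
  by move=> La Lb; rewrite -[a]scale1r; exact: LP.
have Lhpart p a : L a -> L (hpart p a).
  by move=> La; apply/LZ/LD => //; apply/LZ/Lpar.
split=> //.
- move=> p; split; first by split; rewrite // /homog /= linear0 scaler0.
  by move=> k u v [Lu hu] [Lv hv]; split; [apply: LP|apply/homogD/hv/homogZ/hu].
- move=> u Lu; exists (hpart false u, hpart true u); split=> [|[v w] /=].
    split=> /=; last exact: hpart_sum; split; do ?exact: hpart_homog;
      exact: Lhpart.
  move=> [[_ hv] [_ hw] ->]; rewrite !linearD /=.
  by rewrite !(hpart_id _ hv) !(hpart_id _ hw) /= addr0 add0r.
- by move=> k u v w _ _ _; rewrite scommPl scommPr.
split=> //.
- by move=> p q u v [Lu hu] [Lv hv]; split; [apply: Lbr | apply: homog_scomm].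
- by move=> p q u v [Lu hu] [Lv hv]; apply: scomm_anti.
- by move=> p q u v w [Lu hu] [Lv hv] _; apply: scomm_jacobi.
Qed.

End SuperTheory.

(** * Structure constants *)

Section Lincomb.
Context (K : pzRingType) (n : nat).

(** The linear combination of the family [e] with coefficients [k]. *)
Definition lincomb (V : lmodType K) (e : 'I_n -> V) (k : 'rV[K]_n) : V :=
  \sum_i k 0 i *: e i.

Context (V : lmodType K) (e : 'I_n -> V).

Lemma lincomb_is_linear : linear (lincomb e).
Proof.
move=> t k l; rewrite /lincomb scaler_sumr -big_split; apply: eq_bigr => i _.
by rewrite !mxE scalerDl scalerA.
Qed.

HB.instance Definition _ := GRing.isLinear.Build K 'rV[K]_n V *:%R (lincomb e)
  lincomb_is_linear.

Lemma lincomb_delta i : lincomb e (delta_mx 0 i) = e i.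
Proof.
rewrite /lincomb (bigD1 i) //= big1 ?addr0 => [|j /negPf ne].
  by rewrite mxE !eqxx scale1r.
by rewrite mxE ne andbF scale0r.
Qed.

Lemma lincomb_subspace : subspace (range (lincomb e)).
Proof.
split; first by exists 0; rewrite ?linear0.
by move=> t _ _ [k _ <-] [l _ <-]; exists (t *: k + l); rewrite ?linearP.
Qed.

End Lincomb.

Section StructureConstants.
Context (K : numFieldType) (n : nat) (s : 'I_n -> bool).
Context (T : 'I_n -> 'I_n -> 'rV[K]_n).

(** The family [e] consists of homogeneous elements, of parities [s], with
    the structure constants [T]. *)
Definition has_structure (A : superAlg K) (e : 'I_n -> A) : Prop :=
  (forall i, homog (s i) (e i)) /\
  (forall i j, scomm (e i) (e j) = lincomb e (T i j)).

(** The parity and the bracket of [lincomb e], on coefficients. *)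
Definition rV_parity (k : 'rV[K]_n) : 'rV[K]_n :=
  \row_i ((-1) ^+ s i * k 0 i).

Definition rV_bracket (k l : 'rV[K]_n) : 'rV[K]_n :=
  \sum_i \sum_j (k 0 i * l 0 j) *: T i j.

Section OneAlgebra.
Context (A : superAlg K) (e : 'I_n -> A).
Hypothesis eP : has_structure e.

Lemma lincomb_parity k : parity (lincomb e k) = lincomb e (rV_parity k).
Proof.
rewrite /lincomb linear_sum /=; apply: eq_bigr => i _.
by rewrite linearZ /= (proj1 eP i) mxE scalerA mulrC.
Qed.

Lemma lincomb_scomm k l :
  scomm (lincomb e k) (lincomb e l) = lincomb e (rV_bracket k l).
Proof.
rewrite [lincomb e k]/lincomb scomm_suml linear_sum; apply: eq_bigr => i _.
rewrite scommZl [lincomb e l]/lincomb scomm_sumr scaler_sumr linear_sum.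
by apply: eq_bigr => j _; rewrite scommZr (proj2 eP) scalerA [RHS]linearZ.
Qed.

Lemma structure_lie_superalgebra :
  lie_superalgebra (@homog K A) (@scomm K A) (range (lincomb e)).
Proof.
apply: stable_lie_superalgebra; first exact: lincomb_subspace.
- by move=> _ [k _ <-]; rewrite lincomb_parity; eexists.
- by move=> _ _ [k _ <-] [l _ <-]; rewrite lincomb_scomm; eexists.
Qed.

End OneAlgebra.

(** The spans of two free families with the same parities and the same
    structure constants are isomorphic. *)
Lemma structure_iso (A A' : superAlg K) (e : 'I_n -> A) (e' : 'I_n -> A') :
  has_structure e -> has_structure e' ->
  injective (lincomb e) -> injective (lincomb e') ->
  lie_superalgebra_iso (@homog K A) (@scomm K A) (range (lincomb e))
    (@homog K A') (@scomm K A') (range (lincomb e')).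
Proof.
move=> eP eP' inj inj'.
have [g gP] : exists g : A -> 'rV[K]_n, cancel (lincomb e) g.
  have /choice [g gP] :
      forall a, exists k, range (lincomb e) a -> lincomb e k = a.
    by move=> a; have [[k _ <-]|na] := pselect (range (lincomb e) a);
      [exists k | exists 0].
  by exists g => k; apply/inj/gP; exists k.
exists (lincomb e' \o g); split.
- by move=> u _; exists (g u).
- by move=> _ _ [k _ <-] [l _ <-] /=; rewrite !gP => /inj' ->.
- by move=> _ [k _ <-]; exists (lincomb e k); rewrite /= ?gP //; exists k.
split.
- by move=> t _ _ [k _ <-] [l _ <-] /=; rewrite -linearP !gP linearP.
- move=> p _ [k _ <-]; rewrite /homog /= gP !lincomb_parity //.
  by rewrite -!linearZ => /inj ->.
- by move=> _ _ [k _ <-] [l _ <-] /=; rewrite !lincomb_scomm // !gP.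
Qed.

End StructureConstants.

(** * The structure constants of spo(2|2) *)

Section Spo.
Context (K : numFieldType).

(** The brackets of the basis [h, z, e, f, p, m, p', m'] of spo(2|2), row by
    row. The even part is the sum of the copy [e, h, f] of sl(2) and of the line
    of [z]; the odd weight vectors [p], [m], [p'], [m'] have weights [-1], [1],
    [1], [-1] under [h] and [1], [-1], [1], [-1] under [z]. *)
Definition spo_table (V : lmodType K) (h z e f p m p' m' : V) : seq (seq V) :=
  [:: [:: 0; 0; 2 *: e; - (2 *: f); - p; m; p'; - m'];
      [:: 0; 0; 0; 0; p; - m; p'; - m'];
      [:: - (2 *: e); 0; 0; h; - p'; 0; 0; - m];
      [:: 2 *: f; 0; - h; 0; 0; - m'; - p; 0];
      [:: p; - p; p'; 0; 0; h + z; 0; - (2 *: f)];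
      [:: - m; m; 0; m'; h + z; 0; 2 *: e; 0];
      [:: - p'; - p'; 0; p; 0; 2 *: e; 0; h - z];
      [:: m'; m'; m; 0; - (2 *: f); 0; h - z; 0]].

(** Relations that imply the whole table: the brackets of the odd elements,
    and four brackets between [e, f] and the odd elements. *)
Record spo_rel (A : superAlg K) (h z e f p m p' m' : A) : Prop := SpoRel {
  spo_h : homog false h;
  spo_z : homog false z;
  spo_e : homog false e;
  spo_f : homog false f;
  spo_p : homog true p;
  spo_m : homog true m;
  spo_p' : homog true p';
  spo_m' : homog true m';
  spo_pp : scomm p p = 0;
  spo_mm : scomm m m = 0;
  spo_p'p' : scomm p' p' = 0;
  spo_m'm' : scomm m' m' = 0;
  spo_pp' : scomm p p' = 0;
  spo_mm' : scomm m m' = 0;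
  spo_pm : scomm p m = h + z;
  spo_p'm' : scomm p' m' = h - z;
  spo_pm' : scomm p m' = - (2 *: f);
  spo_mp' : scomm m p' = 2 *: e;
  spo_ep : scomm e p = - p';
  spo_fp' : scomm f p' = - p;
  spo_fm : scomm f m = - m';
  spo_em' : scomm e m' = - m }.

Section SpoTable.
Context (A : superAlg K) (h z e f p m p' m' : A).
Hypothesis eP : spo_rel h z e f p m p' m'.

Lemma scommOO a b : homog true a -> homog true b -> scomm a b = scomm b a :> A.
Proof. by move=> ha hb; rewrite (scomm_anti ha hb) /= expr1 scaleN1r opprK. Qed.

Lemma scommEE a : homog false a -> scomm a a = 0 :> A.
Proof. by move=> ha; rewrite (scomm_homog ha ha) expr0 scale1r subrr. Qed.

Lemma jacobiE a b c q : homog false a -> homog q b ->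
  scomm a (scomm b c) = scomm (scomm a b) c + scomm b (scomm a c) :> A.
Proof. by move=> ha hb; rewrite (scomm_jacobi c ha hb) /= expr0 scale1r. Qed.

Lemma jacobiO a b c : homog true a -> homog true b ->
  scomm (scomm a b) c = scomm a (scomm b c) + scomm b (scomm a c) :> A.
Proof.
move=> ha hb; rewrite (scomm_jacobi c ha hb) /= expr1 scaleN1r.
by rewrite -addrA addNr addr0.
Qed.

Lemma addr_eq0_half (a : A) : a + a = 0 -> a = 0.
Proof.
move=> a0; have: 2 *: a = 0 by rewrite scaler_nat mulr2n.
move/(congr1 ( *:%R 2^-1)).
by rewrite scalerA mulVf ?pnatr_eq0 // scale1r scaler0.
Qed.

Lemma scaler2_inj (a b : A) : 2 *: a = 2 *: b -> a = b.
Proof.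
by move/(congr1 ( *:%R 2^-1)); rewrite !scalerA mulVf ?pnatr_eq0 // !scale1r.
Qed.

Lemma sum_diff_inj (u w a b : A) : u + w = a + b -> u - w = a - b ->
  u = a /\ w = b.
Proof.
move=> eD eB; have ua : u = a.
  apply: scaler2_inj; rewrite !scaler_nat !mulr2n.
  have := congr2 +%R eD eB.
  by rewrite addrACA subrr addr0 [a + b + _]addrACA subrr addr0.
by split=> //; move: eD; rewrite ua => /addrI.
Qed.

Let hH := spo_h eP.
Let hZ := spo_z eP.
Let hE := spo_e eP.
Let hF := spo_f eP.
Let hP := spo_p eP.
Let hM := spo_m eP.
Let hP' := spo_p' eP.
Let hM' := spo_m' eP.

Let p'p : scomm p' p = 0. Proof. by rewrite scommOO // (spo_pp' eP). Qed.
Let m'm : scomm m' m = 0. Proof. by rewrite scommOO // (spo_mm' eP). Qed.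
Let m'p : scomm m' p = - (2 *: f).
Proof. by rewrite scommOO // (spo_pm' eP). Qed.
Let p'm : scomm p' m = 2 *: e. Proof. by rewrite scommOO // (spo_mp' eP). Qed.

Lemma oddL a b : homog true a -> homog false b -> scomm a b = - scomm b a :> A.
Proof. by move=> ha hb; rewrite (scomm_anti ha hb) /= expr0 scale1r. Qed.

(** [[a, a] = 0] implies [[[a, b], a] = 0]. *)
Lemma jacobi_square a b : homog true a -> homog true b -> scomm a a = 0 ->
  scomm (scomm a b) a = 0 :> A.
Proof.
move=> ha hb aa; apply: addr_eq0_half; rewrite {1}jacobiO // aa scomm0r addr0.
rewrite (scommOO hb ha) (scomm_anti ha (homog_scomm ha hb)).
by rewrite /= expr0 scale1r addNr.
Qed.

Lemma jacobi_square' a b : homog true a -> homog true b -> scomm b b = 0 ->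
  scomm (scomm a b) b = 0 :> A.
Proof. by move=> ha hb bb; rewrite (scommOO ha hb) jacobi_square. Qed.

Lemma scomm_hz_p : scomm h p = - p /\ scomm z p = p.
Proof.
apply: sum_diff_inj; rewrite -?scommNl -?scommDl ?addNr.
  by rewrite -(spo_pm eP) jacobi_square // (spo_pp eP).
rewrite -(spo_p'm' eP) jacobiO // m'p p'p scomm0r addr0 scommNr scommZr.
by rewrite (oddL hP' hF) (spo_fp' eP) opprK scaler_nat mulr2n opprD.
Qed.

Lemma scomm_hz_m : scomm h m = m /\ scomm z m = - m.
Proof.
apply: sum_diff_inj; rewrite -?scommNl -?scommDl ?subrr ?opprK.
  by rewrite -(spo_pm eP) jacobi_square' // (spo_mm eP).
rewrite -(spo_p'm' eP) jacobiO // m'm p'm scomm0r add0r scommZr.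
by rewrite (oddL hM' hE) (spo_em' eP) opprK scaler_nat mulr2n.
Qed.

Lemma scomm_hz_p' : scomm h p' = p' /\ scomm z p' = p'.
Proof.
apply: sum_diff_inj; rewrite -?scommNl -?scommDl ?subrr; last first.
  by rewrite -(spo_p'm' eP) jacobi_square // (spo_p'p' eP).
rewrite -(spo_pm eP) jacobiO // (spo_mp' eP) (spo_pp' eP) scomm0r addr0.
by rewrite scommZr (oddL hP hE) (spo_ep eP) opprK scaler_nat mulr2n.
Qed.

Lemma scomm_hz_m' : scomm h m' = - m' /\ scomm z m' = - m'.
Proof.
apply: sum_diff_inj; rewrite -?scommNl -?scommDl ?opprK ?addNr; last first.
  by rewrite -(spo_p'm' eP) jacobi_square' // (spo_m'm' eP).
rewrite -(spo_pm eP) jacobiO // (spo_mm' eP) (spo_pm' eP) scomm0r add0r.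
rewrite scommNr scommZr (oddL hM hF) (spo_fm eP) opprK scaler_nat mulr2n.
by rewrite opprD.
Qed.

Lemma scomm_h_e : scomm h e = 2 *: e.
Proof.
apply: scaler2_inj; rewrite -scommZr -(spo_mp' eP).
rewrite (jacobiE _ hH hM) (proj1 scomm_hz_m) (proj1 scomm_hz_p').
by rewrite scaler_nat mulr2n.
Qed.

Lemma scomm_z_e : scomm z e = 0.
Proof.
apply: scaler2_inj; rewrite -scommZr -(spo_mp' eP).
rewrite (jacobiE _ hZ hM) (proj2 scomm_hz_m) (proj2 scomm_hz_p').
by rewrite scommNl addNr scaler0.
Qed.

Lemma scomm_h_f : scomm h f = - (2 *: f).
Proof.
apply: scaler2_inj; apply: oppr_inj.
rewrite -scommZr -scommNr -(spo_pm' eP).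
rewrite (jacobiE _ hH hP) (proj1 scomm_hz_p) (proj1 scomm_hz_m').
by rewrite scommNl scommNr scaler_nat mulr2n opprD.
Qed.

Lemma scomm_z_f : scomm z f = 0.
Proof.
apply: scaler2_inj; apply: oppr_inj.
rewrite -scommZr -scommNr -(spo_pm' eP).
rewrite (jacobiE _ hZ hP) (proj2 scomm_hz_p) (proj2 scomm_hz_m').
by rewrite scommNr subrr scaler0 oppr0.
Qed.

Lemma scomm_e_m : scomm e m = 0.
Proof.
apply: scaler2_inj; rewrite scaler0 -scommZl -p'm.
by rewrite jacobi_square' // (spo_mm eP).
Qed.

Lemma scomm_e_p' : scomm e p' = 0.
Proof.
apply: scaler2_inj; rewrite scaler0 -scommZl -p'm.
by rewrite jacobi_square // (spo_p'p' eP).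
Qed.

Lemma scomm_f_p : scomm f p = 0.
Proof.
apply: scaler2_inj; apply: oppr_inj; rewrite scaler0 -scommZl -scommNl -m'p.
by rewrite jacobi_square' ?oppr0 // (spo_pp eP).
Qed.

Lemma scomm_f_m' : scomm f m' = 0.
Proof.
apply: scaler2_inj; apply: oppr_inj; rewrite scaler0 -scommZl -scommNl -m'p.
by rewrite jacobi_square ?oppr0 // (spo_m'm' eP).
Qed.

Lemma scomm_h_z : scomm h z = 0.
Proof.
have : scomm h (h + z) = 0.
  rewrite -(spo_pm eP) (jacobiE _ hH hP) (proj1 scomm_hz_p) (proj1 scomm_hz_m).
  by rewrite scommNl addNr.
by rewrite scommDr scommEE // add0r.
Qed.

Lemma scomm_e_f : scomm e f = h.
Proof.
apply: scaler2_inj; apply: oppr_inj.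
rewrite -scommZr -scommNr -(spo_pm' eP).
rewrite (jacobiE _ hE hP) (spo_ep eP) (spo_em' eP) scommNl scommNr.
rewrite (spo_p'm' eP) (spo_pm eP) -opprD addrACA addNr addr0.
by rewrite scaler_nat mulr2n.
Qed.

Definition spo_seq (V : Type) (h z e f p m p' m' : V) : seq V :=
  [:: h; z; e; f; p; m; p'; m'].

(** The basis of spo(2|2) as a family. *)
Definition spo_fam (V : zmodType) (h z e f p m p' m' : V) (i : 'I_8) : V :=
  (spo_seq h z e f p m p' m')`_i.

Lemma spo_tableP (i j : 'I_8) :
  scomm (spo_fam h z e f p m p' m' i) (spo_fam h z e f p m p' m' j) =
  (nth [::] (spo_table h z e f p m p' m') i)`_j.
Proof.
have [hp zp] := scomm_hz_p; have [hm zm] := scomm_hz_m.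
have [hp' zp'] := scomm_hz_p'; have [hm' zm'] := scomm_hz_m'.
have eE := (hp, zp, hm, zm, hp', zp', hm', zm', scomm_h_e, scomm_z_e, scomm_h_f,
  scomm_z_f, scomm_e_m, scomm_e_p', scomm_f_p, scomm_f_m', scomm_h_z, scomm_e_f,
  spo_pp eP, spo_mm eP, spo_p'p' eP, spo_m'm' eP, spo_pp' eP, spo_mm' eP,
  spo_pm eP, spo_p'm' eP, spo_pm' eP, spo_mp' eP, spo_ep eP, spo_fp' eP,
  spo_fm eP, spo_em' eP).
case: i => [[|[|[|[|[|[|[|[|i]]]]]]]] Hi] //;
case: j => [[|[|[|[|[|[|[|[|j]]]]]]]] Hj] //; rewrite /spo_fam /=;
rewrite ?eE ?scommEE //;
match goal with |- scomm ?a ?b = _ =>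
  rewrite (@scomm_anti _ _ _ _ a b ltac:(eassumption) ltac:(eassumption)) /=
end; by rewrite ?eE ?expr0 ?expr1 ?scaleN1r ?scale1r ?opprK ?oppr0.
Qed.

End SpoTable.

(** Invertibility of a sign matrix of size 4. *)
Lemma zero_combs (A : superAlg K) (u v w t : A) :
  [/\ u - v + w - t = 0, u + v + w + t = 0, - u - v + w + t = 0 &
      - u + v + w - t = 0] -> [/\ u = 0, v = 0, w = 0 & t = 0].
Proof.
have half a b : a + b = 0 :> A -> a - b = 0 -> a = 0 /\ b = 0.
  by move=> ab ab'; apply: sum_diff_inj; rewrite ?addr0 ?subr0.
move=> [e1 e2 e3 e4].
have [uw vt] : u + w = 0 /\ v + t = 0.
  by apply: half; rewrite ?opprD addrACA addrA.
have [wu vt'] : w - u = 0 /\ v - t = 0.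
  by apply: half; rewrite ?opprB [w - u]addrC 1?[t - v]addrC addrACA addrA.
have [w0 u0] := half _ _ (etrans (addrC w u) uw) wu.
by have [v0 t0] := half _ _ vt vt'.
Qed.

Section SpoStructure.
Context (A : superAlg K) (h z e f p m p' m' : A).
Hypothesis eP : spo_rel h z e f p m p' m'.

(** The last four elements of the basis are odd. *)
Definition spo_parity (i : 'I_8) : bool := (4 <= i)%N.

(** The structure constants: the table for the canonical basis of [K^8]. *)
Definition spo_const (i j : 'I_8) : 'rV[K]_8 :=
  let d k : 'rV[K]_8 := delta_mx 0 (inord k) in
  (nth [::] (spo_table (d 0) (d 1) (d 2) (d 3) (d 4) (d 5) (d 6) (d 7)) i)`_j.

(** The entries of the table are linear expressions in the basis. *)
Lemma spo_table_linear (V V' : lmodType K) (F : V -> V')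
    (h0 z0 e0 f0 p0 m0 p0' m0' : V) (i j : 'I_8) : linear F ->
  F (nth [::] (spo_table h0 z0 e0 f0 p0 m0 p0' m0') i)`_j =
  (nth [::] (spo_table (F h0) (F z0) (F e0) (F f0)
                       (F p0) (F m0) (F p0') (F m0')) i)`_j.
Proof.
move=> linF.
pose G : {linear V -> V'} :=
  HB.pack F (GRing.isLinear.Build K V V' *:%R F linF).
have F0 : F 0 = 0 := linear0 G.
have FN v : F (- v) = - F v := linearN G v.
have FD u v : F (u + v) = F u + F v := linearD G u v.
have FZ k v : F (k *: v) = k *: F v by rewrite -[k *: v]addr0 linF F0 addr0.
case: i => [[|[|[|[|[|[|[|[|i]]]]]]]] Hi] //;
case: j => [[|[|[|[|[|[|[|[|j]]]]]]]] Hj] //=;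
by rewrite ?F0 ?FN ?FD ?FN ?FZ.
Qed.

Lemma spo_structure :
  has_structure spo_parity spo_const (spo_fam h z e f p m p' m').
Proof.
split.
  by case=> [[|[|[|[|[|[|[|[|i]]]]]]]] Hi] //; case: eP.
move=> i j; rewrite (spo_tableP eP); pose g := spo_fam h z e f p m p' m'.
rewrite (spo_table_linear _ _ _ _ _ _ _ _ i j (lincomb_is_linear g)).
rewrite !lincomb_delta.
by rewrite /g /spo_fam !inordK.
Qed.

Lemma lincomb8 (V : lmodType K) (g : 'I_8 -> V) (k : 'rV[K]_8) :
  let t i := k 0 (inord i) *: g (inord i) in
  lincomb g k = t 0%N + t 1%N + t 2%N + t 3%N + t 4%N + t 5%N + t 6%N + t 7%N.
Proof.
rewrite /= /lincomb !big_ord_recl big_ord0 addr0 !addrA.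
by do 8?[congr (_ + _)]; congr (k _ _ *: g _); apply: val_inj;
  rewrite /= inordK.
Qed.

(** If [e] is not zero, then neither are [h, f, p, m, p', m']. The joint
    eigenvalues of [ad h] and [ad z] separate [e, f, p, m, p', m'] from one
    another and from the span of [h] and [z], and the brackets of [h] and [z]
    with [p] and [p'] show that [h] and [z] are independent. *)
Lemma spo_free : e != 0 -> injective (lincomb (spo_fam h z e f p m p' m')).
Proof.
move=> e0.
suff inj0 k : lincomb (spo_fam h z e f p m p' m') k = 0 -> k = 0.
  by move=> k l kl; apply/eqP; rewrite -subr_eq0; apply/eqP/inj0;
     rewrite linearB /= kl subrr.
have h0 : h != 0.
  apply: contra_neq e0 => h0; apply: (@scaler2_inj A).
  by rewrite scaler0 -(scomm_h_e eP) h0 scomm0l.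
have p'0 : p' != 0.
  apply: contra_neq e0 => p0; apply: (@scaler2_inj A).
  by rewrite scaler0 -(spo_mp' eP) p0 scomm0r.
have p0 : p != 0.
  apply: contra_neq p'0 => p0; apply: oppr_inj.
  by rewrite oppr0 -(spo_ep eP) p0 scomm0r.
have m'0 : m' != 0.
  apply: contra_neq h0 => m0; rewrite -(scomm_e_f eP); apply: oppr_inj.
  apply: scaler2_inj; rewrite oppr0 scaler0 scalerN -scommZr -scommNr.
  by rewrite -(spo_pm' eP) m0 !scomm0r.
have m0 : m != 0.
  apply: contra_neq m'0 => m0; apply: oppr_inj.
  by rewrite oppr0 -(spo_fm eP) m0 scomm0r.
have f0 : f != 0.
  by apply: contra_neq h0 => f0; rewrite -(scomm_e_f eP) f0 scomm0r.
have [hp zp] := scomm_hz_p eP; have [hm zm] := scomm_hz_m eP.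
have [hp' zp'] := scomm_hz_p' eP; have [hm' zm'] := scomm_hz_m' eP.
have hzE := (hp, zp, hm, zm, hp', zp', hm', zm', scomm_h_e eP, scomm_z_e eP,
  scomm_h_f eP, scomm_z_f eP, scomm_h_z eP, scommEE (spo_h eP),
  scommEE (spo_z eP)).
rewrite lincomb8 /spo_fam !inordK //=.
have zh : scomm z h = 0.
  by rewrite (scomm_anti (spo_z eP) (spo_h eP)) (scomm_h_z eP) scaler0 oppr0.
set k0 := k 0 (inord 0); set k1 := k 0 (inord 1); set k2 := k 0 (inord 2).
set k3 := k 0 (inord 3); set k4 := k 0 (inord 4); set k5 := k 0 (inord 5).
set k6 := k 0 (inord 6); set k7 := k 0 (inord 7).
move=> k_eq.
have sE (x : K) (a : A) : x *: a = 0 -> a != 0 -> x = 0.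
  have [-> // | x0] := eqVneq x 0; move/(congr1 ( *:%R x^-1)).
  by rewrite scalerA mulVf // scale1r scaler0 => -> /eqP.
(* Applying [ad z], [(ad z)^2], [ad h ad z] and [ad h (ad z)^2] kills the even
   part and gives four sign patterns on the odd part. *)
have /zero_combs [u0 v0 w0 t0] : [/\
    k4 *: p - k5 *: m + k6 *: p' - k7 *: m' = 0,
    k4 *: p + k5 *: m + k6 *: p' + k7 *: m' = 0,
    - (k4 *: p) - k5 *: m + k6 *: p' + k7 *: m' = 0 &
    - (k4 *: p) + k5 *: m + k6 *: p' - k7 *: m' = 0].
  have e1 := congr1 (scomm z) k_eq.
  rewrite !(scommDr, scommZr, scomm0r) !hzE zh !scaler0 !add0r !scalerN in e1.
  have e2 := congr1 (scomm z) e1.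
  rewrite !(scommDr, scommNr, scommZr, scomm0r) !hzE !scalerN !opprK in e2.
  have e3 := congr1 (scomm h) e1.
  rewrite !(scommDr, scommNr, scommZr, scomm0r) !hzE !scalerN !opprK in e3.
  have e4 := congr1 (scomm h) e2.
  by rewrite !(scommDr, scommNr, scommZr, scomm0r) !hzE !scalerN in e4.
rewrite u0 v0 w0 t0 !addr0 in k_eq.
have k4_0 := sE _ _ u0 p0; have k5_0 := sE _ _ v0 m0.
have k6_0 := sE _ _ w0 p'0; have k7_0 := sE _ _ t0 m'0.
(* On the even part, [ad h] and [(ad h)^2] separate [e] from [f]. *)
have [k2_0 k3_0] : k2 *: (2 *: e) = 0 /\ k3 *: (2 *: f) = 0.
  have e1 := congr1 (scomm h) k_eq.
  rewrite !(scommDr, scommZr, scomm0r) !hzE !scaler0 !add0r scalerN in e1.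
  have e2 := congr1 (scomm h) e1.
  rewrite !(scommDr, scommNr, scommZr, scomm0r) !hzE !scalerN opprK in e2.
  have sC (x : K) (a : A) : x *: (2 *: a) = 2 *: (x *: a).
    by rewrite !scalerA mulrC.
  rewrite (sC k2 (2 *: e)) (sC k3 (2 *: f)) -scalerDr in e2.
  apply: sum_diff_inj; rewrite ?addr0 ?subr0 //.
  by apply: scaler2_inj; rewrite e2 scaler0.
have two0 (a : A) : a != 0 -> 2 *: a != 0.
  by apply: contra_neq => a0; apply: scaler2_inj; rewrite a0 scaler0.
have k2_00 := sE _ _ k2_0 (two0 _ e0); have k3_00 := sE _ _ k3_0 (two0 _ f0).
rewrite k2_00 k3_00 !scale0r !addr0 in k_eq.
(* [p] and [p'] have the same eigenvalue under [z] and opposite ones under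
   [h]. *)
have [k0_0 k1_0] : k0 = 0 /\ k1 = 0.
  have e1 := congr1 (fun a : A => scomm a p) k_eq.
  have e2 := congr1 (fun a : A => scomm a p') k_eq.
  rewrite /= !(scommDl, scommZl, scomm0l) !hzE scalerN addrC -scalerBl in e1.
  rewrite /= !(scommDl, scommZl, scomm0l) !hzE addrC -scalerDl in e2.
  have {}e1 := sE _ _ e1 p0; have {}e2 := sE _ _ e2 p'0.
  have k10 : k1 = k0 by apply/eqP; rewrite -subr_eq0 e1.
  have/eqP : k0 *+ 2 = 0 by rewrite mulr2n -[X in X + _]k10.
  by rewrite mulrn_eq0 /= k10 => /eqP ->.
apply/rowP => i; rewrite mxE -(inord_val i).
by case: i => [[|[|[|[|[|[|[|[|i]]]]]]]] Hi].
Qed.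

End SpoStructure.
End Spo.

(** * The matrices of spo(2|2) *)

Section SpoMatrices.
Context (K : numFieldType).

(** The general element of spo(2|2). *)
Definition spo_mx (a b c d x y u v : K) : mx_super K 2 2 :=
  \matrix_(i < 4, j < 4)
    (nth [::] [:: [:: a; b; y; u];
                  [:: c; - a; - v; - x];
                  [:: x; u; d; 0];
                  [:: v; y; 0; - d]] i)`_j.

Lemma mx_parityE (M : mx_super K 2 2) (i j : 'I_4) :
  (parity M : 'M_4) i j = (-1) ^+ ((i < 2)%N (+) (j < 2)%N) * (M : 'M_4) i j.
Proof.
have E (M' : 'M[K]_(2 + 2)) i' j' :
    mx_parity M' i' j' = (-1) ^+ ((i' < 2)%N (+) (j' < 2)%N) * M' i' j'.
  rewrite /mx_parity -[in RHS](submxK M').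
  case: (split_ordP i') => i0 ->; case: (split_ordP j') => j0 ->;
  by rewrite ?(block_mxEul, block_mxEur, block_mxEdl, block_mxEdr) /= ?mxE
     ?ltn_ord /= ?ltnNge ?leq_addr /= ?expr0 ?expr1 ?mul1r ?mulN1r.
exact: E.
Qed.

Lemma spo_mx_even a b c d : homog false (spo_mx a b c d 0 0 0 0).
Proof.
rewrite /homog /= expr0 scale1r; apply/matrixP => i j.
rewrite (mx_parityE (spo_mx a b c d 0 0 0 0)) !mxE.
case: i => [[|[|[|[|i]]]] Hi] //; case: j => [[|[|[|[|j]]]] Hj] //=;
by rewrite ?oppr0 ?mulr0 ?expr0 ?mul1r.
Qed.

Lemma spo_mx_odd x y u v : homog true (spo_mx 0 0 0 0 x y u v).
Proof.
rewrite /homog /= expr1 scaleN1r; apply/matrixP => i j.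
rewrite (mx_parityE (spo_mx 0 0 0 0 x y u v)) !mxE.
case: i => [[|[|[|[|i]]]] Hi] //; case: j => [[|[|[|[|j]]]] Hj] //=;
by rewrite ?oppr0 ?mulr0 ?expr1 ?mulN1r.
Qed.

Lemma spo_mx_oddodd x y u v x' y' u' v' :
  scomm (spo_mx 0 0 0 0 x y u v) (spo_mx 0 0 0 0 x' y' u' v') =
  spo_mx (x * y' + y * x' + (u * v' + v * u')) (2 * (y * u' + u * y'))
    (- (2 * (x * v' + v * x'))) (x * y' + y * x' - (u * v' + v * u')) 0 0 0 0.
Proof.
rewrite (scomm_homog (spo_mx_odd _ _ _ _) (spo_mx_odd _ _ _ _)) expr1 scaleN1r.
rewrite opprK; apply/matrixP => i j; rewrite !mxE !big_ord_recl !big_ord0 !mxE.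
case: i => [[|[|[|[|i]]]] Hi] //; case: j => [[|[|[|[|j]]]] Hj] //=; ring.
Qed.

Lemma spo_mx_evenodd b c x y u v :
  scomm (spo_mx 0 b c 0 0 0 0 0) (spo_mx 0 0 0 0 x y u v) =
  spo_mx 0 0 0 0 (- (c * u)) (- (b * v)) (- (b * x)) (- (c * y)).
Proof.
rewrite (scomm_homog (spo_mx_even _ _ _ _) (spo_mx_odd _ _ _ _)) expr0 scale1r.
apply/matrixP => i j; rewrite !mxE !big_ord_recl !big_ord0 !mxE.
case: i => [[|[|[|[|i]]]] Hi] //; case: j => [[|[|[|[|j]]]] Hj] //=; ring.
Qed.

Lemma spo_mxP k a b c d x y u v a' b' c' d' x' y' u' v' :
  k *: spo_mx a b c d x y u v + spo_mx a' b' c' d' x' y' u' v' =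
  spo_mx (k * a + a') (k * b + b') (k * c + c') (k * d + d')
    (k * x + x') (k * y + y') (k * u + u') (k * v + v').
Proof.
apply/matrixP => i j; rewrite !mxE.
case: i => [[|[|[|[|i]]]] Hi] //; case: j => [[|[|[|[|j]]]] Hj] //=; ring.
Qed.

Lemma spo_mx0 : spo_mx 0 0 0 0 0 0 0 0 = 0.
Proof.
apply/matrixP => i j; rewrite !mxE.
by case: i => [[|[|[|[|i]]]] Hi] //; case: j => [[|[|[|[|j]]]] Hj] //=;
  rewrite oppr0.
Qed.

Lemma spo_mxZ k a b c d x y u v : k *: spo_mx a b c d x y u v =
  spo_mx (k * a) (k * b) (k * c) (k * d) (k * x) (k * y) (k * u) (k * v).
Proof. by rewrite -[LHS]addr0 -spo_mx0 spo_mxP !addr0. Qed.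

Lemma spo_mxN a b c d x y u v : - spo_mx a b c d x y u v =
  spo_mx (- a) (- b) (- c) (- d) (- x) (- y) (- u) (- v).
Proof. by rewrite -scaleN1r spo_mxZ !mulN1r. Qed.

Lemma spo_mxD a b c d x y u v a' b' c' d' x' y' u' v' :
  spo_mx a b c d x y u v + spo_mx a' b' c' d' x' y' u' v' =
  spo_mx (a + a') (b + b') (c + c') (d + d')
    (x + x') (y + y') (u + u') (v + v').
Proof. by rewrite -[spo_mx a b _ _ _ _ _ _]scale1r spo_mxP !mul1r. Qed.

(* The coordinates [a, d, b, c, x, y, u, v] of a matrix are its coefficients on
   [h, z, e, f, p, m, p', m'], in this order. *)
Let h := spo_mx 1 0 0 0 0 0 0 0.
Let z := spo_mx 0 0 0 1 0 0 0 0.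
Let e := spo_mx 0 1 0 0 0 0 0 0.
Let f := spo_mx 0 0 1 0 0 0 0 0.
Let p := spo_mx 0 0 0 0 1 0 0 0.
Let m := spo_mx 0 0 0 0 0 1 0 0.
Let p' := spo_mx 0 0 0 0 0 0 1 0.
Let m' := spo_mx 0 0 0 0 0 0 0 1.

Lemma spo_mx_rel : spo_rel h z e f p m p' m'.
Proof.
split; rewrite ?spo_mx_oddodd ?spo_mx_evenodd -?spo_mx0
  /h /z /e /f /p /m /p' /m' ?spo_mxZ ?spo_mxN ?spo_mxD;
  do ?exact: spo_mx_even; do ?exact: spo_mx_odd;
by congr spo_mx; ring.
Qed.

Definition spo_mx_fam : 'I_8 -> mx_super K 2 2 := spo_fam h z e f p m p' m'.

Lemma spo_mx_structure :
  has_structure spo_parity (@spo_const K) spo_mx_fam.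
Proof. exact: spo_structure spo_mx_rel. Qed.

Lemma spo_mx_free : injective (lincomb spo_mx_fam).
Proof.
apply: (spo_free spo_mx_rel); apply/negP => /eqP /matrixP /(_ ord0 (inord 1)).
by rewrite !mxE /= inordK //= => /eqP; rewrite oner_eq0.
Qed.

Lemma lincomb_spo_mx (k : 'rV[K]_8) : lincomb spo_mx_fam k =
  spo_mx (k 0 (inord 0)) (k 0 (inord 2)) (k 0 (inord 3)) (k 0 (inord 1))
    (k 0 (inord 4)) (k 0 (inord 5)) (k 0 (inord 6)) (k 0 (inord 7)).
Proof.
rewrite lincomb8 /spo_mx_fam /spo_fam !inordK //=.
rewrite /h /z /e /f /p /m /p' /m' !spo_mxZ !spo_mxD.
by congr spo_mx; ring.
Qed.

Lemma range_spo_mx : range (lincomb spo_mx_fam) = @spo22 K.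
Proof.
apply/seteqP; split=> [_ [k _ <-] | M [a [b [c [d [x [y [u [v ->]]]]]]]]].
  by rewrite lincomb_spo_mx; do 8!eexists.
exists (\row_i [:: a; d; b; c; x; y; u; v]`_i) => //.
by rewrite lincomb_spo_mx !mxE !inordK.
Qed.

End SpoMatrices.

(** * Bilinearity of the tensor product *)

Section TensorLinear.
Context (K : pzRingType) (A B : pzAlgType K).
Implicit Types (a b : A) (u v : B).

Lemma tens_linear_r a : linear (@tens K A B a).
Proof. by move=> k u v; exact: tensPr. Qed.
Lemma tens_linear_l u : linear (fun a : A => tens a u).
Proof. by move=> k a b; exact: tensPl. Qed.

HB.instance Definition _ a :=
  GRing.isLinear.Build K B (tensor A B) *:%R (tens a) (tens_linear_r a).

Let tensl u := fun a => tens a u.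
HB.instance Definition _ u :=
  GRing.isLinear.Build K A (tensor A B) *:%R (tensl u) (tens_linear_l u).

Lemma tens0l u : tens 0 u = 0 :> tensor A B.
Proof. exact: (linear0 (tensl u)). Qed.
Lemma tensDl a b u : tens (a + b) u = tens a u + tens b u :> tensor A B.
Proof. exact: (linearD (tensl u)). Qed.
Lemma tensNl a u : tens (- a) u = - tens a u :> tensor A B.
Proof. exact: (linearN (tensl u)). Qed.
Lemma tensZl k a u : tens (k *: a) u = k *: tens a u :> tensor A B.
Proof. by rewrite -[k *: a]addr0 tensPl tens0l addr0. Qed.
Lemma tens_suml (I : Type) (r : seq I) (P : pred I) (F : I -> A) u :
  tens (\sum_(i <- r | P i) F i) u =
  \sum_(i <- r | P i) tens (F i) u :> tensor A B.
Proof. exact: (linear_sum (tensl u)). Qed.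
Lemma tensDr a u v : tens a (u + v) = tens a u + tens a v :> tensor A B.
Proof. exact: linearD. Qed.
Lemma tensNr a u : tens a (- u) = - tens a u :> tensor A B.
Proof. exact: linearN. Qed.
Lemma tens0r a : tens a 0 = 0 :> tensor A B.
Proof. exact: linear0. Qed.
Lemma tensZr k a u : tens a (k *: u) = k *: tens a u :> tensor A B.
Proof. exact: linearZ. Qed.
Lemma tens_sumr (I : Type) (r : seq I) (P : pred I) (F : I -> B) a :
  tens a (\sum_(i <- r | P i) F i) =
  \sum_(i <- r | P i) tens a (F i) :> tensor A B.
Proof. exact: linear_sum. Qed.

End TensorLinear.

(** * The complexified inner product *)

Section Gram.
Context (K : comNzRingType) (r : nat) (G : 'M[K]_r) (b : 'I_r -> 'cV[K]_r).

(** An orthonormal family of [r] vectors of [K^r] is a basis. *)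
Lemma orthonormal_expand :
  (forall i j, ((b i)^T *m G *m b j) 0 0 = (i == j)%:R) ->
  forall w, \sum_i ((b i)^T *m G *m w) 0 0 *: b i = w.
Proof.
move=> bP w; pose Y := \matrix_(i, j) b j i 0.
have YE j : col j Y = b j by apply/matrixP => i k; rewrite !mxE ord1.
have rowE i : row i (Y^T *m G) = (b i)^T *m G by rewrite row_mul -tr_col YE.
have Y1 : (Y^T *m G) *m Y = 1%:M.
  apply/matrixP => i j; rewrite !mxE -bP mxE -rowE.
  by apply: eq_bigr => k _; rewrite -YE !mxE.
rewrite -[RHS](mul1mx w) -(mulmx1C Y1) -[RHS]mulmxA.
apply/matrixP => i j; rewrite summxE mxE; apply: eq_bigr => k _.
by rewrite ord1 mulrC -rowE -row_mul !mxE.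
Qed.

End Gram.

Section Pairing.
Context (R : realType) (r : nat) (G : 'M[R]_r).
Local Notation C := R[i].
Implicit Types (u v w : 'cV[C]_r) (a : 'cV[R]_r).

Lemma cpairDl u v w : cpair G (u + v) w = cpair G u w + cpair G v w.
Proof. by rewrite /cpair linearD /= !mulmxDl mxE. Qed.
Lemma cpairDr u v w : cpair G w (u + v) = cpair G w u + cpair G w v.
Proof. by rewrite /cpair mulmxDr mxE. Qed.
Lemma cpairZl k v w : cpair G (k *: v) w = k * cpair G v w.
Proof. by rewrite /cpair linearZ /= -!scalemxAl mxE. Qed.
Lemma cpairZr k v w : cpair G w (k *: v) = k * cpair G w v.
Proof. by rewrite /cpair -!scalemxAr mxE. Qed.
Lemma cpair0l w : cpair G 0 w = 0.
Proof. by rewrite -(scale0r 0) cpairZl mul0r. Qed.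
Lemma cpair0r w : cpair G w 0 = 0.
Proof. by rewrite -(scale0r 0) cpairZr mul0r. Qed.
Lemma cpairNl v w : cpair G (- v) w = - cpair G v w.
Proof. by rewrite -scaleN1r cpairZl mulN1r. Qed.
Lemma cpairNr v w : cpair G w (- v) = - cpair G w v.
Proof. by rewrite -scaleN1r cpairZr mulN1r. Qed.

Lemma cpairC : G^T = G -> forall v w, cpair G v w = cpair G w v.
Proof.
move=> GT v w; rewrite /cpair -[in LHS](trmxK (_ *m _ *m w)) [LHS]mxE.
by rewrite !trmx_mul trmxK /cplx map_trmx GT mulmxA.
Qed.

Lemma cpair_cplx a a' : cpair G (cplx a) (cplx a') = (inner G a a')%:C.
Proof. by rewrite /cpair /cplx map_trmx -!map_mxM mxE. Qed.

Lemma cplxB m n (M N : 'M[R]_(m, n)) : cplx (M - N) = cplx M - cplx N.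
Proof. exact: map_mxB. Qed.
Lemma cplxN m n (M : 'M[R]_(m, n)) : cplx (- M) = - cplx M.
Proof. exact: map_mxN. Qed.
Lemma cplxZ m n k (M : 'M[R]_(m, n)) : cplx (k *: M) = k%:C *: cplx M.
Proof. exact: map_mxZ. Qed.
Lemma cplxM m n p (M : 'M[R]_(m, n)) (N : 'M[R]_(n, p)) :
  cplx (M *m N) = cplx M *m cplx N.
Proof. exact: map_mxM. Qed.
Lemma cplx1 n : cplx (1%:M : 'M[R]_n) = 1%:M.
Proof. exact: map_mx1. Qed.

End Pairing.

(** * Relations in the Cherednik and Clifford algebras *)

Section RootGeometry.
Context (R : realType) (r : nat) (G : 'M[R]_r) (a : 'cV[R]_r).
Hypothesis aa : inner G a a != 0.

Lemma inner_coroot : inner G a (coroot G a) = 2.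
Proof. by rewrite /inner /coroot -scalemxAr mxE -/(inner G a a) divfK. Qed.

Lemma refl_root : refl G a *m a = - a.
Proof.
rewrite reflE /coroot scalerA mulrC divfK // scaler_nat mulr2n opprD addrA.
by rewrite subrr sub0r.
Qed.

Lemma refl_coroot : refl G a *m coroot G a = - coroot G a.
Proof. by rewrite /coroot -scalemxAr refl_root scalerN. Qed.

End RootGeometry.

(** The commutators of [y] with [x^2] and of [y^2] with [x] when
    [[y, x] = k - d]. *)
Section CommutatorSquare.
Context (K : pzRingType) (A : pzAlgType K) (y x d : A) (k : K).
Hypothesis yx : y * x - x * y = k *: (1 : A) - d.

Let split2 (u : A) : (k *: (1 : A) - d) * u + u * (k *: (1 : A) - d)
  = (k * 2) *: u - (d * u + u * d).
Proof.
rewrite mulrBl mulrBr -pzscalerAl -pzscalerAr mul1r mulr1 addrACA opprD.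
by rewrite mulr_natr -scalerDl mulr2n.
Qed.

Lemma comm_sqr_r : y * x ^+ 2 - x ^+ 2 * y = (k * 2) *: x - (d * x + x * d).
Proof.
rewrite -split2 -yx mulrBl mulrBr !mulrA addrA.
by rewrite subrK expr2 ?mulrA.
Qed.

Lemma comm_sqr_l : y ^+ 2 * x - x * y ^+ 2 = (k * 2) *: y - (d * y + y * d).
Proof.
rewrite -split2 -yx [RHS]addrC mulrBl mulrBr !mulrA addrA.
by rewrite subrK expr2 ?mulrA.
Qed.

End CommutatorSquare.

Section HRelations.
Context (R : realType) (r : nat) (G : 'M[R]_r).
Context (Phi Phip : {fset 'cV[R]_r}) (c : 'cV[R]_r -> R[i]).
Hypothesis Gip : inner_product G.
Hypothesis Phi_roots : root_system G Phi.
Hypothesis Phip_pos : positive_roots G Phi Phip.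
Local Notation C := R[i].
Local Notation V := 'cV[C]_r.

Local Notation Hc := (cherednik G Phi Phip c).
Local Notation Cl := (clifford G).
Local Notation A := (HC G Phi Phip c).

(** The generators given by the vectors [v] of [h] (suffix [y]) and of [h^*]
    (suffix [x]), in the Cherednik algebra (prefix [H]) and in the Clifford
    algebra (prefix [C]), and the reflections. *)
Definition Hgy (v : V) : Hc := Hv G Phi Phip c (in_h v).
Definition Hgx (v : V) : Hc := Hv G Phi Phip c (in_hd v).
Definition Cgy (v : V) : Cl := Cv G (in_h v).
Definition Cgx (v : V) : Cl := Cv G (in_hd v).
Definition Hs (a : 'cV[R]_r) : Hc := Hw Phip c (sW G Phi a).

Lemma Phip_sub a : a \in Phip -> a \in Phi.
Proof. by case: Phip_pos => t [_ ->] => /andP[]. Qed.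

Lemma root_norm_neq0 a : a \in Phi -> inner G a a != 0.
Proof.
move=> aP; apply/lt0r_neq0/(proj2 Gip).
by apply: contraTneq aP => ->; case: Phi_roots.
Qed.

Lemma Hv_linear : linear (Hv G Phi Phip c).
Proof.
by move=> k u v; have := pcl_rel (CRlin G Phi Phip c k u v); rewrite !pclE.
Qed.

Lemma Cv_linear : linear (Cv G).
Proof. by move=> k u v; have := pcl_rel (KRlin G k u v); rewrite !pclE. Qed.

Lemma in_h_linear : linear (@in_h R r).
Proof. by move=> k u v; congr pair; rewrite /= scaler0 addr0. Qed.
Lemma in_hd_linear : linear (@in_hd R r).
Proof. by move=> k u v; congr pair; rewrite /= scaler0 addr0. Qed.

Lemma Hgy_linear : linear Hgy.
Proof. by move=> k u v; rewrite /Hgy in_h_linear Hv_linear. Qed.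
Lemma Hgx_linear : linear Hgx.
Proof. by move=> k u v; rewrite /Hgx in_hd_linear Hv_linear. Qed.
Lemma Cgy_linear : linear Cgy.
Proof. by move=> k u v; rewrite /Cgy in_h_linear Cv_linear. Qed.
Lemma Cgx_linear : linear Cgx.
Proof. by move=> k u v; rewrite /Cgx in_hd_linear Cv_linear. Qed.

HB.instance Definition _ := GRing.isLinear.Build C V Hc *:%R Hgy Hgy_linear.
HB.instance Definition _ := GRing.isLinear.Build C V Hc *:%R Hgx Hgx_linear.
HB.instance Definition _ := GRing.isLinear.Build C V Cl *:%R Cgy Cgy_linear.
HB.instance Definition _ := GRing.isLinear.Build C V Cl *:%R Cgx Cgx_linear.

Lemma HgxZ k v : Hgx (k *: v) = k *: Hgx v. Proof. exact: linearZ. Qed.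
Lemma HgyZ k v : Hgy (k *: v) = k *: Hgy v. Proof. exact: linearZ. Qed.
Lemma CgxZ k v : Cgx (k *: v) = k *: Cgx v. Proof. exact: linearZ. Qed.
Lemma CgyZ k v : Cgy (k *: v) = k *: Cgy v. Proof. exact: linearZ. Qed.

Lemma HgyC u v : Hgy u * Hgy v = Hgy v * Hgy u.
Proof.
apply/eqP; rewrite -subr_eq0; apply/eqP.
by have := pcl_rel (CRyy G Phi Phip c u v); rewrite !pclE.
Qed.

Lemma HgxC u v : Hgx u * Hgx v = Hgx v * Hgx u.
Proof.
apply/eqP; rewrite -subr_eq0; apply/eqP.
by have := pcl_rel (CRxx G Phi Phip c u v); rewrite !pclE.
Qed.

(** The reflection part of the commutator [[y, x]]. *)
Definition refl_part (y x : V) : Hc :=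
  \sum_(a <- Phip) (c a * cpair G (cplx a) y * cpair G x (cplx (coroot G a)))
     *: Hs a.

Lemma HgyxC y x : Hgy y * Hgx x - Hgx x * Hgy y =
  cpair G x y *: (1 : Hc) - refl_part y x.
Proof. exact: Hyx. Qed.

Lemma Hs_x a v : a \in Phi -> Hs a * Hgx v = Hgx (cplx (refl G a) *m v) * Hs a.
Proof.
move=> aP; have := pcl_rel (CRact Phip c (sW G Phi a) 0 v).
by rewrite !pclE mulmx0 (val_sW G aP).
Qed.

Lemma Hs_y a v : a \in Phi -> Hs a * Hgy v = Hgy (cplx (refl G a) *m v) * Hs a.
Proof.
move=> aP; have := pcl_rel (CRact Phip c (sW G Phi a) v 0).
by rewrite !pclE mulmx0 (val_sW G aP).
Qed.

Lemma Cv_anti u v : Cv G u * Cv G v + Cv G v * Cv G u = cliffB G u v *: (1 : Cl).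
Proof. by have := pcl_rel (KRB G u v); rewrite !pclE. Qed.

Lemma CgyyA u v : Cgy u * Cgy v + Cgy v * Cgy u = 0.
Proof. by rewrite Cv_anti /cliffB /= !cpair0l addr0 scale0r. Qed.
Lemma CgxxA u v : Cgx u * Cgx v + Cgx v * Cgx u = 0.
Proof. by rewrite Cv_anti /cliffB /= !cpair0r addr0 scale0r. Qed.
Lemma CgxyA u v : Cgx u * Cgy v + Cgy v * Cgx u = cpair G u v *: (1 : Cl).
Proof. by rewrite Cv_anti /cliffB /= cpair0r addr0. Qed.
Lemma CgyxA u v : Cgy u * Cgx v + Cgx v * Cgy u = cpair G v u *: (1 : Cl).
Proof. by rewrite addrC CgxyA. Qed.

Context (b : 'I_r -> V).
Hypothesis b_on : forall i j, cpair G (b i) (b j) = (i == j)%:R.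

Lemma b_expand w : \sum_i cpair G (b i) w *: b i = w.
Proof. exact: orthonormal_expand. Qed.

Lemma b_expand' w : \sum_i cpair G w (b i) *: b i = w.
Proof.
rewrite -[RHS]b_expand; apply: eq_bigr => i _; congr (_ *: _).
by apply: cpairC; case: Gip.
Qed.

Lemma Hs_coroot_x a : a \in Phi ->
  Hs a * Hgx (cplx (coroot G a)) + Hgx (cplx (coroot G a)) * Hs a = 0.
Proof.
move=> aP; rewrite Hs_x // -cplxM refl_coroot ?root_norm_neq0 //.
by rewrite cplxN linearN mulNr addNr.
Qed.

Lemma Hs_root_y a : a \in Phi ->
  Hs a * Hgy (cplx a) + Hgy (cplx a) * Hs a = 0.
Proof.
move=> aP; rewrite Hs_y // -cplxM refl_root ?root_norm_neq0 //.
by rewrite cplxN linearN mulNr addNr.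
Qed.

(** [[y, sum_j x_j^2] = 2 x_y], where [x_y] is [y] seen in [h^*]: the
    reflection terms cancel because [s_a] maps the coroot of [a] to its
    opposite. *)
Lemma Hgy_sum_sqr y :
  Hgy y * (\sum_j Hgx (b j) ^+ 2) - (\sum_j Hgx (b j) ^+ 2) * Hgy y =
  2 *: Hgx y.
Proof.
rewrite mulr_sumr mulr_suml -sumrB.
rewrite (eq_bigr _ (fun j _ => comm_sqr_r (HgyxC y (b j)))) sumrB.
rewrite [X in _ - X]big_split /= -[X in _ - X]addr0.
have -> : \sum_j (cpair G (b j) y * 2) *: Hgx (b j) = 2 *: Hgx y.
  rewrite -{2}(b_expand y) linear_sum scaler_sumr.
  by apply: eq_bigr => j _; rewrite linearZ /= scalerA mulrC.
suff -> : \sum_j refl_part y (b j) * Hgx (b j) +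
    \sum_j Hgx (b j) * refl_part y (b j) = 0.
  by rewrite addr0 subr0.
rewrite -big_split /= /refl_part.
under eq_bigr => j _ do rewrite mulr_suml mulr_sumr -big_split /=.
rewrite exchange_big /= big_seq big1 // => a aP.
under eq_bigr => j _ do rewrite -pzscalerAl -pzscalerAr -scalerDr -scalerA.
rewrite -scaler_sumr; under eq_bigr => j _ do
  rewrite scalerDr pzscalerAr pzscalerAl -HgxZ.
rewrite big_split /= -mulr_sumr -mulr_suml -linear_sum b_expand.
by rewrite Hs_coroot_x ?scaler0 ?Phip_sub.
Qed.

(** [[sum_j y_j^2, x] = 2 y_x], where [y_x] is [x] seen in [h]; here it is [a]
    that [s_a] maps to its opposite. *)
Lemma sum_sqr_Hgx x :
  (\sum_j Hgy (b j) ^+ 2) * Hgx x - Hgx x * (\sum_j Hgy (b j) ^+ 2) =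
  2 *: Hgy x.
Proof.
rewrite mulr_sumr mulr_suml -sumrB.
rewrite (eq_bigr _ (fun j _ => comm_sqr_l (HgyxC (b j) x))) sumrB.
rewrite [X in _ - X]big_split /= -[X in _ - X]addr0.
have -> : \sum_j (cpair G x (b j) * 2) *: Hgy (b j) = 2 *: Hgy x.
  rewrite -{2}(b_expand' x) linear_sum scaler_sumr.
  by apply: eq_bigr => j _; rewrite linearZ /= scalerA mulrC.
suff -> : \sum_j refl_part (b j) x * Hgy (b j) +
    \sum_j Hgy (b j) * refl_part (b j) x = 0.
  by rewrite addr0 subr0.
rewrite -big_split /= /refl_part.
under eq_bigr => j _ do rewrite mulr_suml mulr_sumr -big_split /=.
rewrite exchange_big /= big_seq big1 // => a aP.
under eq_bigr => j _ do
  rewrite -pzscalerAl -pzscalerAr -scalerDr mulrAC -scalerA.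
rewrite -scaler_sumr; under eq_bigr => j _ do
  rewrite scalerDr pzscalerAr pzscalerAl -HgyZ.
rewrite big_split /= -mulr_sumr -mulr_suml -linear_sum b_expand'.
by rewrite Hs_root_y ?scaler0 ?Phip_sub.
Qed.

(** * Supercommutators in the tensor product *)

Lemma Cgy_odd v : homog true (Cgy v). Proof. exact: Cv_odd. Qed.
Lemma Cgx_odd v : homog true (Cgx v). Proof. exact: Cv_odd. Qed.

Lemma homog_tens_sum (P : 'I_r -> Hc) (u : 'I_r -> Cl) :
  (forall i, homog true (u i)) -> homog true (\sum_i (tens (P i) (u i) : A)).
Proof. by move=> hu; apply: homog_sum => i; apply: tens_homog. Qed.

Lemma homog_tens1 (a : Hc) : homog false (tens a 1 : A).
Proof.
by apply: tens_homog; rewrite /homog /= expr0 scale1r; exact: cliff_parity1.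
Qed.

Lemma scomm_tens_odd (P Q : 'I_r -> Hc) (u v : 'I_r -> Cl) :
  (forall i, homog true (u i)) -> (forall i, homog true (v i)) ->
  scomm (\sum_i (tens (P i) (u i) : A)) (\sum_j (tens (Q j) (v j) : A)) =
  \sum_i \sum_j (tens (P i * Q j) (u i * v j) + tens (Q j * P i) (v j * u i)).
Proof.
move=> hu hv; rewrite (scomm_homog (homog_tens_sum P hu) (homog_tens_sum Q hv)).
rewrite expr1 scaleN1r opprK !mulr_suml.
under eq_bigr => i _ do rewrite mulr_sumr.
under [X in _ + X]eq_bigr => j _ do rewrite mulr_sumr.
rewrite [X in _ + X]exchange_big -big_split; apply: eq_bigr => i _.
rewrite -big_split; apply: eq_bigr => j _.
by congr (_ + _); exact: tensM.
Qed.

Lemma scomm_tens_even (a : Hc) (P : 'I_r -> Hc) (u : 'I_r -> Cl) :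
  (forall i, homog true (u i)) ->
  scomm (tens a 1 : A) (\sum_i (tens (P i) (u i) : A)) =
  \sum_i tens (a * P i - P i * a) (u i).
Proof.
move=> hu; rewrite (scomm_homog (homog_tens1 a) (homog_tens_sum P hu)).
rewrite expr0 scale1r mulr_suml mulr_sumr -sumrB; apply: eq_bigr => i _.
have E x y s t : (tens x s : A) * (tens y t : A) = tens (x * y) (s * t) by exact: tensM.
by rewrite !E mul1r mulr1 -tensNl -tensDl.
Qed.

Lemma scomm_tens_commuting (P Q : 'I_r -> Hc) (u v : 'I_r -> Cl)
    (beta : 'I_r -> 'I_r -> C) :
  (forall i, homog true (u i)) -> (forall i, homog true (v i)) ->
  (forall i j, P i * Q j = Q j * P i) ->
  (forall i j, u i * v j + v j * u i = beta i j *: (1 : Cl)) ->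
  scomm (\sum_i (tens (P i) (u i) : A)) (\sum_j (tens (Q j) (v j) : A)) =
  tens (\sum_i \sum_j beta i j *: (P i * Q j)) 1.
Proof.
move=> hu hv PQ uv; rewrite scomm_tens_odd // tens_suml; apply: eq_bigr => i _.
rewrite tens_suml; apply: eq_bigr => j _.
by rewrite -PQ -tensDr uv tensZr tensZl.
Qed.

Lemma sum_delta (W : lmodType C) (F : 'I_r -> 'I_r -> W) :
  \sum_i \sum_j (i == j)%:R *: F i j = \sum_i F i i.
Proof.
apply: eq_bigr => i _; rewrite (bigD1 i) //= eqxx scale1r big1 ?addr0 // => j.
by rewrite eq_sym => /negPf ->; rewrite scale0r.
Qed.

Lemma sum3_exchange (W : nmodType) (s : seq 'cV[R]_r)
    (F : 'I_r -> 'I_r -> 'cV[R]_r -> W) :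
  \sum_i \sum_j \sum_(a <- s) F i j a = \sum_(a <- s) \sum_i \sum_j F i j a.
Proof.
by rewrite [RHS]exchange_big; apply: eq_bigr => i _; rewrite exchange_big.
Qed.

(** The bracket of [sum_i y_i (x) phi(b_i)] and [sum_j x_j (x) psi(b_j)]. The
    commutators [[y_i, x_j]] contribute [sum_i phi(b_i) psi(b_i)] and, by the
    expansion of [a] and of its coroot on the basis [b], one term per positive
    root [a]. *)
Lemma scomm_tens_yx (phi psi : {linear V -> Cl}) (beta : 'I_r -> 'I_r -> C) :
  (forall v, homog true (phi v)) -> (forall v, homog true (psi v)) ->
  (forall i j, phi (b i) * psi (b j) + psi (b j) * phi (b i)
    = beta i j *: (1 : Cl)) ->
  scomm (\sum_i (tens (Hgy (b i)) (phi (b i)) : A))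
        (\sum_j (tens (Hgx (b j)) (psi (b j)) : A)) =
  tens (\sum_i \sum_j beta i j *: (Hgx (b j) * Hgy (b i))) 1 +
  (\sum_i tens 1 (phi (b i) * psi (b i)) -
   \sum_(a <- Phip) c a *:
     tens (Hs a) (phi (cplx a) * psi (cplx (coroot G a)))).
Proof.
move=> hphi hpsi uv; rewrite scomm_tens_odd //.
transitivity (\sum_i \sum_j (tens (beta i j *: (Hgx (b j) * Hgy (b i))) 1 +
  (((i == j)%:R *: tens 1 (phi (b i) * psi (b j))) -
   tens (refl_part (b i) (b j)) (phi (b i) * psi (b j)))) : tensor Hc Cl).
  apply: eq_bigr => i _; apply: eq_bigr => j _.
  have -> : Hgy (b i) * Hgx (b j) =
      Hgx (b j) * Hgy (b i) + ((i == j)%:R *: (1 : Hc) - refl_part (b i) (b j)).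
    by rewrite eq_sym -b_on -HgyxC addrC subrK.
  rewrite tensDl addrAC -tensDr uv tensZr -tensZl; congr (_ + _).
  by rewrite tensDl tensNl tensZl.
under eq_bigr => i _ do rewrite big_split /=.
rewrite big_split /=; congr (_ + _).
  by rewrite tens_suml; apply: eq_bigr => i _; rewrite tens_suml.
under eq_bigr => i _ do rewrite sumrB.
rewrite sumrB sum_delta; congr (_ - _).
transitivity (\sum_i \sum_j \sum_(a <- Phip)
   (cpair G (cplx a) (b i) * cpair G (b j) (cplx (coroot G a))) *:
     (c a *: tens (Hs a) (phi (b i) * psi (b j)) : tensor Hc Cl)).
  apply: eq_bigr => i _; apply: eq_bigr => j _.
  rewrite /refl_part tens_suml; apply: eq_bigr => a _.
  by rewrite tensZl scalerA [_ * c a]mulrC mulrA.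
apply: etrans (sum3_exchange _ _) _; apply: eq_bigr => a _.
rewrite -[in RHS](b_expand' (cplx a)) -[in RHS](b_expand (cplx (coroot G a))).
rewrite !linear_sum mulr_suml tens_sumr scaler_sumr; apply: eq_bigr => i _.
rewrite mulr_sumr tens_sumr scaler_sumr; apply: eq_bigr => j _.
rewrite !linearZ /= -pzscalerAl -pzscalerAr !tensZr !scalerA.
by congr (_ *: _); rewrite mulrC mulrA.
Qed.

End HRelations.

(** * The spo(2|2) relations in the tensor product *)

Section SpoRelations.
Context (R : realType) (r : nat) (G : 'M[R]_r).
Context (Phi Phip : {fset 'cV[R]_r}) (c : 'cV[R]_r -> R[i]).
Hypothesis Gip : inner_product G.
Hypothesis Phi_roots : root_system G Phi.
Hypothesis Phip_pos : positive_roots G Phi Phip.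
Context (y : 'I_r -> 'cV[R]_r).
Hypothesis y_on : orthonormal_family G y.
Local Notation C := R[i].
Local Notation V := 'cV[C]_r.

Local Notation Hc := (cherednik G Phi Phip c).
Local Notation Cl := (clifford G).
Local Notation A := (HC G Phi Phip c).

(** The dual basis of an orthonormal basis is the basis itself, under the
    identification of [E^*] with [E]. *)
Lemma dual_basis_eq (x : 'I_r -> 'cV[R]_r) : dual_basis G y x -> x = y.
Proof.
move=> xy; apply/funext => i; rewrite -[LHS](orthonormal_expand y_on).
rewrite -[RHS](orthonormal_expand y_on); apply: eq_bigr => j _; congr (_ *: _).
rewrite -!/(inner G _ _).
have innerC u v : inner G u v = inner G v u.
  rewrite /inner -[in LHS](trmxK (_ *m _ *m v)) [LHS]mxE.
  by rewrite !trmx_mul trmxK (proj1 Gip) mulmxA.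
by rewrite innerC xy y_on eq_sym.
Qed.

Let b i : V := cplx (y i).

Lemma b_on i j : cpair G (b i) (b j) = (i == j)%:R.
Proof. by rewrite cpair_cplx y_on; case: eqP. Qed.

Let X i : Hc := Hgx G Phi Phip c (b i).
Let Y i : Hc := Hgy G Phi Phip c (b i).
Let xi i : Cl := Cgx G (b i).
Let eta i : Cl := Cgy G (b i).

(* The terms of which [H], [Z] and the brackets of odd elements are made. *)
Let TXY : tensor Hc Cl := tens (\sum_i X i * Y i) 1.
Let Nxe : tensor Hc Cl := \sum_i tens 1 (xi i * eta i).
Let Sref : tensor Hc Cl := \sum_(a <- Phip) c a *: tens (Hs G Phi Phip c a) 1.
Let Stau : tensor Hc Cl := \sum_(a <- Phip) c a *:
  tens (Hs G Phi Phip c a) (Cgx G (cplx a) * Cgy G (cplx (coroot G a))).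
Let r2 : C := r%:R / 2.

Lemma halfD (W : lmodType C) (u : W) : 2^-1 *: u + 2^-1 *: u = u.
Proof. by rewrite -scalerDl -[2^-1]mul1r -splitr scale1r. Qed.

Lemma r2D : r2 + r2 = r%:R.
Proof. by rewrite /r2 -splitr. Qed.

Lemma root_cpair a : a \in Phip -> cpair G (cplx a) (cplx (coroot G a)) = 2.
Proof.
move=> aP; rewrite cpair_cplx inner_coroot; first exact: rmorph_nat.
by apply: (root_norm_neq0 Gip Phi_roots); apply: (Phip_sub Phip_pos aP).
Qed.

Lemma sum_refl_part : \sum_i refl_part G Phi Phip c (b i) (b i) =
  2 *: \sum_(a <- Phip) c a *: Hs G Phi Phip c a.
Proof.
rewrite /refl_part exchange_big scaler_sumr /= big_seq [RHS]big_seq.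
apply: eq_bigr => a aP; rewrite -scaler_suml scalerA; congr (_ *: _).
under eq_bigr => i _ do rewrite -mulrA.
rewrite -mulr_sumr mulrC; congr (_ * _); rewrite -(root_cpair aP).
rewrite -[in RHS](b_expand b_on (cplx (coroot G a))).
rewrite (big_morph (cpair G (cplx a)) (fun u v => cpairDr G u v _) (cpair0r _ _)).
by apply: eq_bigr => i _; rewrite cpairZr mulrC.
Qed.

Lemma elHE : elH G Phi Phip c y y = TXY + (r2 *: (1 : tensor Hc Cl) - Sref).
Proof.
have -> : elH G Phi Phip c y y =
  tens (\sum_i 2^-1 *: (X i * Y i + Y i * X i)) 1 by [].
transitivity (tens (\sum_i (X i * Y i + (2^-1 *: (1 : Hc) -
    2^-1 *: refl_part G Phi Phip c (b i) (b i)))) 1 : tensor Hc Cl).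
  congr (tens _ _); apply: eq_bigr => i _.
  have E : (1 : Hc) - refl_part G Phi Phip c (b i) (b i) = Y i * X i - X i * Y i.
    by rewrite /Y /X HgyxC b_on eqxx scale1r.
  rewrite -scalerBr E -[X in _ = X + _](halfD (X i * Y i)) -addrA -scalerDr.
  by rewrite [X in _ = _ + _ *: X]addrC subrK scalerDr.
rewrite big_split sumrB -!scaler_sumr sum_refl_part scalerA mulVf ?pnatr_eq0 //.
rewrite scale1r sumr_const card_ord tensDl; congr (_ + _).
rewrite tensDl tensNl tens_suml -(scaler_nat r (1 : Hc)) scalerA mulrC.
rewrite tensZl tens1.
by congr (_ - _); apply: eq_bigr => a _; rewrite tensZl.
Qed.

Lemma elZE : elZ G Phi Phip c y y =
  Nxe - r2 *: (1 : tensor Hc Cl) + (Sref - Stau).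
Proof.
have -> : elZ G Phi Phip c y y =
  \sum_i tens 1 (2^-1 *: (xi i * eta i - eta i * xi i)) +
  \sum_(a <- Phip) c a *: tens (Hs G Phi Phip c a)
    (1 - Cgx G (cplx a) * Cgy G (cplx (coroot G a))) by [].
congr (_ + _); last first.
  by rewrite -sumrB; apply: eq_bigr => a _; rewrite tensDr tensNr scalerBr.
transitivity (\sum_i (tens (1 : Hc) (xi i * eta i) -
    2^-1 *: (1 : tensor Hc Cl))).
  apply: eq_bigr => i _.
  rewrite -tens1 -tensZr -tensNr -tensDr; congr (tens _ _).
  have -> : eta i * xi i = (1 : Cl) - xi i * eta i.
    have := CgyxA G (b i) (b i); rewrite b_on eqxx scale1r => <-.
    by rewrite addrK.
  by rewrite opprB addrA scalerBr scalerDr halfD.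
rewrite sumrB sumr_const card_ord.
by rewrite -(scaler_nat r (_ *: (1 : tensor Hc Cl))) scalerA.
Qed.

(* The odd elements, up to sign. *)
Let Pp : A := \sum_i tens (Y i) (xi i).
Let Pm : A := \sum_i tens (X i) (eta i).
Let Pp' : A := \sum_i tens (X i) (xi i).
Let Pm' : A := \sum_i tens (Y i) (eta i).

Let xi_odd i : homog true (xi i). Proof. exact: Cgx_odd. Qed.
Let eta_odd i : homog true (eta i). Proof. exact: Cgy_odd. Qed.
Let XXC i j : X i * X j = X j * X i. Proof. exact: HgxC. Qed.
Let YYC i j : Y i * Y j = Y j * Y i. Proof. exact: HgyC. Qed.
Let xixi i j : xi i * xi j + xi j * xi i = 0 *: (1 : Cl).
Proof. by rewrite scale0r; exact: CgxxA. Qed.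
Let etaeta i j : eta i * eta j + eta j * eta i = 0 *: (1 : Cl).
Proof. by rewrite scale0r; exact: CgyyA. Qed.
Let xieta i j : xi i * eta j + eta j * xi i = (i == j)%:R *: (1 : Cl).
Proof. by rewrite -b_on; exact: CgxyA. Qed.
Let etaxi i j : eta i * xi j + xi j * eta i = (i == j)%:R *: (1 : Cl).
Proof. by rewrite eq_sym -b_on; exact: CgyxA. Qed.

Lemma Pp_odd : homog true Pp. Proof. exact: homog_tens_sum. Qed.
Lemma Pm_odd : homog true Pm. Proof. exact: homog_tens_sum. Qed.
Lemma Pp'_odd : homog true Pp'. Proof. exact: homog_tens_sum. Qed.
Lemma Pm'_odd : homog true Pm'. Proof. exact: homog_tens_sum. Qed.

Let sum0 (F : 'I_r -> 'I_r -> Hc) : (\sum_i \sum_j 0 *: F i j) = 0.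
Proof. by apply: big1 => i _; apply: big1 => j _; rewrite scale0r. Qed.

Lemma scomm_PpPp : scomm Pp Pp = 0.
Proof. by rewrite (scomm_tens_commuting _ _ YYC xixi) // sum0 tens0l. Qed.
Lemma scomm_PmPm : scomm Pm Pm = 0.
Proof. by rewrite (scomm_tens_commuting _ _ XXC etaeta) // sum0 tens0l. Qed.
Lemma scomm_Pp'Pp' : scomm Pp' Pp' = 0.
Proof. by rewrite (scomm_tens_commuting _ _ XXC xixi) // sum0 tens0l. Qed.
Lemma scomm_Pm'Pm' : scomm Pm' Pm' = 0.
Proof. by rewrite (scomm_tens_commuting _ _ YYC etaeta) // sum0 tens0l. Qed.
Lemma scomm_PpPm' : scomm Pp Pm' = tens (\sum_i Y i ^+ 2) 1.
Proof. by rewrite (scomm_tens_commuting _ _ YYC xieta) // sum_delta. Qed.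
Lemma scomm_PmPp' : scomm Pm Pp' = tens (\sum_i X i ^+ 2) 1.
Proof. by rewrite (scomm_tens_commuting _ _ XXC etaxi) // sum_delta. Qed.

Let sqr0 (phi : V -> Cl) : (forall v, phi v * phi v + phi v * phi v = 0) ->
  forall v, phi v * phi v = 0.
Proof. by move=> h v; rewrite -[LHS]halfD -scalerDr h scaler0. Qed.

Let root_sqr (phi : {linear V -> Cl}) a :
  (forall v, phi v * phi v + phi v * phi v = 0) ->
  phi (cplx a) * phi (cplx (coroot G a)) = 0.
Proof.
by move=> h; rewrite /coroot cplxZ linearZ /= -pzscalerAr sqr0 ?scaler0.
Qed.

Let Cx_lin : {linear V -> Cl} := Cgx G.
Let Cy_lin : {linear V -> Cl} := Cgy G.

Lemma scomm_PpPp' : scomm Pp Pp' = 0.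
Proof.
have -> := scomm_tens_yx Phi Phip c Gip b_on (phi := Cx_lin) (psi := Cx_lin)
  (@Cgx_odd _ _ _) (@Cgx_odd _ _ _) xixi.
rewrite sum0 tens0l add0r !big1 ?subrr // => [a _|i _].
  by rewrite (root_sqr (phi := Cx_lin)) ?tens0r ?scaler0 // => v; exact: CgxxA.
by rewrite (sqr0 (phi := Cx_lin)) ?tens0r // => v; exact: CgxxA.
Qed.

Lemma scomm_PmPm' : scomm Pm Pm' = 0.
Proof.
rewrite (scommOO Pm_odd Pm'_odd).
have -> := scomm_tens_yx Phi Phip c Gip b_on (phi := Cy_lin) (psi := Cy_lin)
  (@Cgy_odd _ _ _) (@Cgy_odd _ _ _) etaeta.
rewrite sum0 tens0l add0r !big1 ?subrr // => [a _|i _].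
  by rewrite (root_sqr (phi := Cy_lin)) ?tens0r ?scaler0 // => v; exact: CgyyA.
by rewrite (sqr0 (phi := Cy_lin)) ?tens0r // => v; exact: CgyyA.
Qed.

Lemma scomm_PpPm : scomm Pp Pm = TXY + (Nxe - Stau).
Proof.
have -> := scomm_tens_yx Phi Phip c Gip b_on (phi := Cx_lin) (psi := Cy_lin)
  (@Cgx_odd _ _ _) (@Cgy_odd _ _ _) xieta.
under eq_bigr => i _ do under eq_bigr => j _ do rewrite eq_sym.
by rewrite exchange_big sum_delta.
Qed.

Lemma tau_swap a : a \in Phip ->
  Cgy G (cplx a) * Cgx G (cplx (coroot G a)) =
  2 *: (1 : Cl) - Cgx G (cplx a) * Cgy G (cplx (coroot G a)).
Proof.
move=> aP; rewrite -(root_cpair aP) -CgyxA /coroot cplxZ CgxZ CgyZ.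
by rewrite -!pzscalerAr -pzscalerAl addrK.
Qed.

Lemma scomm_Pm'Pp' : scomm Pm' Pp' =
  TXY + (r%:R *: (1 : tensor Hc Cl) - Nxe - (2 *: Sref - Stau)).
Proof.
have -> := scomm_tens_yx Phi Phip c Gip b_on (phi := Cy_lin) (psi := Cx_lin)
  (@Cgy_odd _ _ _) (@Cgx_odd _ _ _) etaxi.
congr (_ + _).
  under eq_bigr => i _ do under eq_bigr => j _ do rewrite eq_sym.
  by rewrite exchange_big sum_delta.
congr (_ - _).
  transitivity (\sum_i ((1 : tensor Hc Cl) - tens 1 (xi i * eta i))).
    apply: eq_bigr => i _; rewrite -tens1 -tensNr -tensDr; congr (tens _ _).
    by have := etaxi i i; rewrite eqxx scale1r => <-; rewrite addrK.
  by rewrite sumrB sumr_const card_ord -(scaler_nat r (1 : tensor Hc Cl)).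
rewrite scaler_sumr -sumrB big_seq [RHS]big_seq; apply: eq_bigr => a aP.
by rewrite tau_swap // tensDr tensNr scalerBr tensZr !scalerA mulrC.
Qed.

Let half2 (W : lmodType C) (u : W) : 2^-1 *: (2 *: u) = u.
Proof. by rewrite scalerA mulVf ?pnatr_eq0 // scale1r. Qed.

Let E1p : A := elE1p G Phi Phip c y.
Let E1m : A := elE1m G Phi Phip c y.

Lemma elE1pE : E1p = - (2^-1 *: (tens (\sum_i X i ^+ 2) 1 : A)).
Proof. by rewrite /E1p /elE1p -scaler_sumr -tensZl. Qed.

Lemma elE1mE : E1m = 2^-1 *: (tens (\sum_i Y i ^+ 2) 1 : A).
Proof. by rewrite /E1m /elE1m -scaler_sumr -tensZl. Qed.

Lemma scomm_sqrX (u : 'I_r -> Cl) : (forall i, homog true (u i)) ->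
  scomm E1p (\sum_i (tens (Y i) (u i) : A)) = \sum_i tens (X i) (u i).
Proof.
move=> hu; rewrite elE1pE scommNl scommZl scomm_tens_even // -scaleNr scaler_sumr.
apply: eq_bigr => i _; rewrite -opprB (Hgy_sum_sqr c Gip Phi_roots Phip_pos b_on).
by rewrite tensNl tensZl scalerN scaleNr opprK half2.
Qed.

Lemma scomm_sqrY (u : 'I_r -> Cl) : (forall i, homog true (u i)) ->
  scomm E1m (\sum_i (tens (X i) (u i) : A)) = \sum_i tens (Y i) (u i).
Proof.
move=> hu; rewrite elE1mE scommZl scomm_tens_even // scaler_sumr.
apply: eq_bigr => i _; rewrite (sum_sqr_Hgx c Gip Phi_roots Phip_pos b_on).
by rewrite tensZl half2.
Qed.

Lemma cherednik_spo_rel :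
  spo_rel (elH G Phi Phip c y y) (elZ G Phi Phip c y y) E1p E1m
    (elE2p G Phi Phip c y y) (elE2m G Phi Phip c y y)
    (elE3p G Phi Phip c y) (elE3m G Phi Phip c y).
Proof.
have oddN u : homog true u -> homog true (- u : A) by exact: homogN.
have pm : scomm Pp Pm = elH G Phi Phip c y y + elZ G Phi Phip c y y.
  have sum_eq (W : zmodType) (n q s s' : W) :
      n - s' = q - s + (n - q + (s - s')).
    by rewrite addrCA subrKA subrKA.
  rewrite elHE elZE scomm_PpPm -[RHS]addrA; congr (_ + _); exact: sum_eq.
have p'm' : scomm Pp' Pm' = elH G Phi Phip c y y - elZ G Phi Phip c y y.
  have sum_eq (W : zmodType) (n q s s' : W) :
      q + q - n - (s + s - s') = q - s - (n - q + (s - s')).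
    rewrite [in LHS]opprB [in RHS]opprD !opprB [RHS]addrCA -[q + q - n]addrA.
    rewrite [q + (q - n)]addrC -addrA.
    by congr (_ + _); rewrite addrA [RHS]addrACA opprD addrA.
  rewrite (scommOO Pp'_odd Pm'_odd) scomm_Pm'Pp' elHE elZE -[RHS]addrA.
  congr (_ + _); rewrite -r2D scalerDl scaler_nat mulr2n; exact: sum_eq.
have homH : homog false (elH G Phi Phip c y y) by exact: homog_tens1.
have homE : homog false E1p by rewrite elE1pE; apply/homogN/homogZ/homog_tens1.
have homF : homog false E1m by rewrite elE1mE; apply/homogZ/homog_tens1.
have homZ : homog false (elZ G Phi Phip c y y).
  rewrite -[elZ _ _ _ _ _ _](addKr (elH G Phi Phip c y y)) -pm.
  by apply: homogD; [apply: homogN | exact: homog_scomm Pp_odd Pm_odd].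
split=> //.
- exact: Pp_odd.
- exact: Pm_odd.
- exact: oddN Pp'_odd.
- exact: oddN Pm'_odd.
- exact: scomm_PpPp.
- exact: scomm_PmPm.
- by rewrite -[LHS]/(scomm (- Pp') (- Pp')) scommNl scommNr opprK scomm_Pp'Pp'.
- by rewrite -[LHS]/(scomm (- Pm') (- Pm')) scommNl scommNr opprK scomm_Pm'Pm'.
- by rewrite -[LHS]/(scomm Pp (- Pp')) scommNr scomm_PpPp' oppr0.
- by rewrite -[LHS]/(scomm Pm (- Pm')) scommNr scomm_PmPm' oppr0.
- by rewrite -[LHS]/(scomm (- Pp') (- Pm')) scommNl scommNr opprK p'm'.
- rewrite -[LHS]/(scomm Pp (- Pm')) scommNr scomm_PpPm' elE1mE; congr (- _).
  by rewrite scalerA mulfV ?pnatr_eq0 // scale1r.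
- rewrite -[LHS]/(scomm Pm (- Pp')) scommNr scomm_PmPp' elE1pE scalerN.
  congr (- _).
  by rewrite scalerA mulfV ?pnatr_eq0 // scale1r.
- by rewrite -[RHS]/(- - Pp') opprK; exact: scomm_sqrX.
- by rewrite -[LHS]/(scomm E1m (- Pp')) scommNr; congr (- _); exact: scomm_sqrY.
- by rewrite -[RHS]/(- - Pm') opprK; exact: scomm_sqrY.
- by rewrite -[LHS]/(scomm E1p (- Pm')) scommNr; congr (- _); exact: scomm_sqrX.
Qed.

End SpoRelations.

(** * Modules of linear maps and endomorphism algebras *)

Section Linmap.
Context (K : comPzRingType) (U V : lmodType K).

Definition lin_pred : {pred U -> V} := [pred f | `[< linear f >]].

Fact lin_pred_submod : submod_closed lin_pred.
Proof.
split; first by apply/asboolP => k u v; rewrite scaler0 addr0.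
move=> t f g /asboolP lf /asboolP lg; apply/asboolP => k u v.
by rewrite !fctE lf lg !scalerDr !scalerA [t * k]mulrC addrACA.
Qed.

HB.instance Definition _ := GRing.isSubmodClosed.Build K (U -> V) lin_pred
  lin_pred_submod.

(** The module of linear maps from [U] to [V]. *)
Record linmap := Linmap { linfn :> U -> V; linfnP : linfn \in lin_pred }.

HB.instance Definition _ := [isSub for linfn].
HB.instance Definition _ := [Choice of linmap by <:].
HB.instance Definition _ := [SubChoice_isSubLmodule of linmap by <:].

Definition mk_linmap (f : U -> V) (fP : linear f) : linmap :=
  Linmap (introT (asboolP (linear f)) fP).

Lemma linmapP (f : linmap) : linear f.
Proof. exact/asboolP/linfnP. Qed.

Lemma linmap_ext (f g : linmap) : f =1 g -> f = g.
Proof. by move=> fg; apply/val_inj/funext. Qed.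

Lemma linmapD (f g : linmap) u : (f + g) u = f u + g u. Proof. by []. Qed.
Lemma linmapZ k (f : linmap) u : (k *: f) u = k *: f u. Proof. by []. Qed.
HB.instance Definition _ (f : linmap) :=
  GRing.isLinear.Build K U V *:%R f (linmapP f).

End Linmap.

Section EndAlgebra.
Context (K : comPzRingType) (V : lmodType K).
Local Notation E := (linmap V V).

Definition end_one : E := @mk_linmap K V V id (fun _ _ _ => erefl).

Fact end_comp_linear (f g : E) : linear (f \o g).
Proof. by move=> k u v; rewrite /= !linearP. Qed.
Definition end_mul (f g : E) : E := mk_linmap (@end_comp_linear f g).

Fact end_mulA : associative end_mul.
Proof. by move=> f g h; apply: linmap_ext. Qed.
Fact end_mul1l : left_id end_one end_mul.
Proof. by move=> f; apply: linmap_ext. Qed.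
Fact end_mul1r : right_id end_one end_mul.
Proof. by move=> f; apply: linmap_ext. Qed.
Fact end_mulDl : left_distributive end_mul +%R.
Proof. by move=> f g h; apply: linmap_ext. Qed.
Fact end_mulDr : right_distributive end_mul +%R.
Proof. by move=> f g h; apply: linmap_ext => u; exact: linearD. Qed.

HB.instance Definition _ := GRing.Zmodule_isPzRing.Build E
  end_mulA end_mul1l end_mul1r end_mulDl end_mulDr.

Fact end_scaleAl k (f g : E) : k *: (f * g) = (k *: f) * g.
Proof. exact: linmap_ext. Qed.
Fact end_scaleAr k (f g : E) : k *: (f * g) = f * (k *: g).
Proof. by apply: linmap_ext => u; symmetry; exact: linearZ. Qed.

(** The algebra of endomorphisms of [V]. *)
Definition end_alg : pzAlgType K :=
  @PzAlgType K E (fun k (f : E) => k *: f)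
    (@scalerA _ _) (@scale1r _ _) (@scalerDr _ _) (fun v k l => scalerDl v k l)
    end_scaleAl end_scaleAr.

Definition endapp (f : end_alg) (v : V) : V := (f : E) v.

Lemma endappD f g v : endapp (f + g) v = endapp f v + endapp g v.
Proof. by []. Qed.
Lemma endappN f v : endapp (- f) v = - endapp f v. Proof. by []. Qed.
Lemma endappZ k f v : endapp (k *: f) v = k *: endapp f v. Proof. by []. Qed.
Lemma endapp1 v : endapp 1 v = v. Proof. by []. Qed.
Lemma endappM f g v : endapp (f * g) v = endapp f (endapp g v).
Proof. by []. Qed.
Lemma endapp_sum (I : Type) (s : seq I) (F : I -> end_alg) u :
  endapp (\sum_(i <- s) F i) u = \sum_(i <- s) endapp (F i) u.
Proof. by elim/big_rec2: _ => // i f g _ <-. Qed.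
Lemma endapp_linear f : linear (endapp f).
Proof. by move=> k u v; exact: linmapP. Qed.
Lemma endapp_ext (f g : end_alg) : endapp f =1 endapp g -> f = g.
Proof. exact: linmap_ext. Qed.

HB.instance Definition _ (f : end_alg) :=
  GRing.isLinear.Build K V V *:%R (endapp f) (endapp_linear f).

End EndAlgebra.

(** * Symmetric and exterior algebras, and their twisted derivations *)

Section Qsym.
Context (K : comPzRingType) (V : lmodType K) (e : K).

Inductive qsym_rel : fterm K V -> fterm K V -> Prop :=
| QSlin k u v : qsym_rel (FGen (k *: u + v)) (k *: FGen u + FGen v)
| QScomm u v : qsym_rel (FGen u * FGen v) (e *: (FGen v * FGen u)).

(** The algebra generated by [V] with the relations [u v = e v u]: the
    symmetric algebra for [e = 1], the exterior algebra for [e = -1] if 2 is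
    invertible. *)
Definition qsym : pzAlgType K := presalg qsym_rel.

Definition qs (v : V) : qsym := pgen qsym_rel v.

Lemma qs_linear : linear qs.
Proof. by move=> k u v; have := pcl_rel (QSlin k u v); rewrite !pclE. Qed.

HB.instance Definition _ := GRing.isLinear.Build K V qsym *:%R qs qs_linear.

Lemma qsC u v : qs u * qs v = e *: (qs v * qs u).
Proof. by have := pcl_rel (QScomm u v); rewrite !pclE. Qed.

Lemma qsym_ind (P : qsym -> Prop) : P 1 ->
  (forall k a a', P a -> P a' -> P (k *: a + a')) ->
  (forall v a, P a -> P (qs v * a)) -> forall a, P a.
Proof.
move=> P1 PP Pv.
have P0 : P 0 by have := PP (-1) 1 1 P1 P1; rewrite scaleN1r addNr.
have PD a a' : P a -> P a' -> P (a + a').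
  by move=> Pa Pa'; rewrite -[a]scale1r; exact: PP.
have PZ k a : P a -> P (k *: a) by move=> Pa; rewrite -[k *: a]addr0; exact: PP.
move=> a; rewrite -[a]mulr1; move: (1 : qsym) P1.
elim/presalg_gen_ind: a =>
  [v m Pm|m Pm|m Pm|a a' Pa Pa' m Pm|a a' Pa Pa' m Pm|k a Pa m Pm].
- exact: Pv.
- by rewrite mul0r.
- by rewrite mul1r.
- by rewrite mulrDl; apply: PD; [exact: Pa|exact: Pa'].
- by rewrite -mulrA; apply/Pa/Pa'.
- by rewrite -pzscalerAl; apply/PZ/Pa.
Qed.

Section QsymLift.
Context (B : pzAlgType K) (f : V -> B).
Hypothesis f_lin : linear f.
Hypothesis fC : forall u v, f u * f v = e *: (f v * f u).

(** The universal property of [qsym]. *)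
Definition qlift : qsym -> B := plift f.

Fact qlift_rel s t : qsym_rel s t -> feval f s = feval f t.
Proof. by case=> [k u v|u v] /=; [exact: f_lin | exact: fC]. Qed.

Lemma qlift_linear : linear qlift. Proof. exact: (pliftP qlift_rel). Qed.
Lemma qlift1 : qlift 1 = 1. Proof. exact: (plift1 qlift_rel). Qed.
Lemma qliftM a b : qlift (a * b) = qlift a * qlift b.
Proof. exact: (pliftM qlift_rel). Qed.
Lemma qlift_qs v : qlift (qs v) = f v. Proof. exact: (plift_gen qlift_rel). Qed.

End QsymLift.

Section Contraction.
Context (delta : V -> qsym -> qsym).
Hypothesis delta_linl : forall m, linear (delta^~ m).
Hypothesis delta_linr : forall u, linear (delta u).
Hypothesis deltaC : forall u v m,
  delta u (qs v * m) + e *: (qs u * delta v m) =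
  e *: (delta v (qs u * m) + e *: (qs v * delta u m)).

Let W : lmodType K := (qsym * qsym)%type.

Let step (u : V) (w : W) : W := (qs u * w.1, e *: (qs u * w.2) + delta u w.1).

Let stepP u : linear (step u).
Proof.
move=> k [m n] [m' n']; rewrite /step /=; congr pair => /=.
  by rewrite mulrDr pzscalerAr.
rewrite mulrDr -pzscalerAr delta_linr !scalerDr !scalerA [e * k]mulrC.
by rewrite addrACA.
Qed.

Let rho u : end_alg W := mk_linmap (stepP u).

Let rhoE u w : endapp (rho u) w = step u w. Proof. by []. Qed.

Let rho_lin : linear rho.
Proof.
move=> k u v; apply: endapp_ext => -[m n].
rewrite endappD endappZ !rhoE /step /=; congr pair => /=.
  by rewrite linearP mulrDl -pzscalerAl.
rewrite linearP /= delta_linl mulrDl -pzscalerAl !scalerDr !scalerA.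
rewrite [e * k]mulrC.
by rewrite addrACA.
Qed.

Let rhoC u v : rho u * rho v = e *: (rho v * rho u).
Proof.
apply: endapp_ext => -[m n]; rewrite endappZ !endappM !rhoE /step /=.
congr pair => /=; first by rewrite !mulrA qsC -pzscalerAl.
rewrite mulrDr scalerDr -!addrA [X in _ + X]addrC deltaC.
rewrite [in RHS]mulrDr ![in RHS]scalerDr -!addrA; congr (_ + _).
  by rewrite -!pzscalerAr !mulrA [qs u * qs v]qsC -pzscalerAl !scalerA.
by rewrite scalerDr addrC.
Qed.

(** The twisted derivation [T] of [qsym] with [T 1 = 0] and
    [T (u m) = e u (T m) + delta u m]: it is read off the second component of
    the representation of [qsym] on [qsym * qsym] for which [u] acts by
    [(m, n) |-> (u m, e u n + delta u m)]. *)
Lemma twisted_derivation : exists T : qsym -> qsym,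
  [/\ linear T, T 1 = 0 &
      forall u m, T (qs u * m) = e *: (qs u * T m) + delta u m].
Proof.
pose w0 : W := (1, 0).
pose F m := endapp (qlift rho m) w0.
have F_lin : linear F.
  by move=> k m m'; rewrite /F qlift_linear // endappD endappZ.
have F1 : F 1 = w0 by rewrite /F qlift1.
have FM u m : F (qs u * m) = step u (F m).
  by rewrite /F qliftM // endappM qlift_qs.
have F_fst m : (F m).1 = m.
  elim/qsym_ind: m => [|k m m' IH IH'|u m IH].
  - by rewrite F1.
  - by rewrite F_lin /= IH IH'.
  - by rewrite FM /= IH.
exists (fun m => (F m).2); split=> [k m m'||u m].
- by rewrite F_lin.
- by rewrite F1.
- by rewrite FM /step /= F_fst.
Qed.

End Contraction.

End Qsym.

Section RegularAlgebra.
Context (K : comPzRingType).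

Fact reg_scaleAr (k u v : K) : k * (u * v) = u * (k * v).
Proof. exact: mulrCA. Qed.

(** [K] as an algebra over itself. *)
Definition reg_alg : pzAlgType K :=
  @PzAlgType K K *%R (@mulrA K) (@mul1r K) (@mulrDr K)
    (fun v k l => mulrDl k l v) (@mulrA K) reg_scaleAr.

End RegularAlgebra.

(** * A normalized functional on the Clifford algebra *)

Section CliffordFunctional.
Context (R : realType) (r : nat) (G : 'M[R]_r).
Local Notation C := R[i].
Local Notation V := 'cV[C]_r.
Local Notation Lam := (@qsym C V (-1)).
Local Notation Cl := (clifford G).

(** The contraction of the exterior algebra by a vector of [h]. *)
Lemma contraction_ex (y : V) : exists T : Lam -> Lam,
  [/\ linear T, T 1 = 0 &
      forall u m,
        T (qs (-1) u * m) = (-1) *: (qs (-1) u * T m) + cpair G u y *: m].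
Proof.
apply: (@twisted_derivation _ _ _ (fun u (m : Lam) => cpair G u y *: m)).
- by move=> m k u v; rewrite cpairDl cpairZl scalerDl scalerA.
- by move=> u k m m'; rewrite scalerDr !scalerA mulrC.
- by move=> u v m; rewrite !scaleN1r opprB -!pzscalerAr.
Qed.

Let contr (y : V) : Lam -> Lam := sval (cid (contraction_ex y)).

Let contr_lin y : linear (contr y).
Proof. by rewrite /contr; case: cid => T []. Qed.
Let contr1 y : contr y 1 = 0.
Proof. by rewrite /contr; case: cid => T []. Qed.
Let contrM y u m :
  contr y (qs (-1) u * m) = - (qs (-1) u * contr y m) + cpair G u y *: m.
Proof. by rewrite /contr; case: cid => T [_ _ /= ->]; rewrite scaleN1r. Qed.

Let contr_lin_y k y y' m : contr (k *: y + y') m = k *: contr y m + contr y' m.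
Proof.
elim/qsym_ind: m => [|t m m' IH IH'|u m IH].
- by rewrite !contr1 scaler0 addr0.
- rewrite !contr_lin IH IH' !scalerDr !scalerA [t * k]mulrC addrACA.
  by rewrite -!addrA; congr (_ + _).
- rewrite !contrM IH mulrDr opprD cpairDr cpairZr scalerDl -scalerA.
  by rewrite scalerDr addrACA scalerN -pzscalerAr.
Qed.

Let contr0 y : contr y 0 = 0.
Proof. by have := contr_lin y (-1) 0 0; rewrite scaler0 addr0 scaleN1r addNr. Qed.
Let contrD y m m' : contr y (m + m') = contr y m + contr y m'.
Proof. by have := contr_lin y 1 m m'; rewrite !scale1r. Qed.
Let contrZ y k m : contr y (k *: m) = k *: contr y m.
Proof. by have := contr_lin y k m 0; rewrite contr0 !addr0. Qed.
Let contrN y m : contr y (- m) = - contr y m.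
Proof. by have := contrZ y (-1) m; rewrite !scaleN1r. Qed.

Let contr_anti y y' m : contr y (contr y' m) + contr y' (contr y m) = 0.
Proof.
elim/qsym_ind: m => [|t m m' IH IH'|u m IH].
- by rewrite !contr1 !contr0 addr0.
- by rewrite !contr_lin addrACA -scalerDr IH IH' scaler0 addr0.
- rewrite !contrM !contrD !contrN !contrZ !contrM.
  rewrite !opprD !opprK addrACA [X in X + _]addrACA -mulrDr IH mulr0 add0r.
  by rewrite -opprD [X in _ + X]addrC addNr.
Qed.

(* [h] acts on the exterior algebra of [h^*] by contractions, and [h^*] by left
   multiplications. *)
Let cl_act (v : hh R r) (m : Lam) : Lam := contr v.1 m + qs (-1) v.2 * m.

Let cl_act_lin v : linear (cl_act v).
Proof.
move=> k m m'; rewrite /cl_act contr_lin mulrDr -pzscalerAr scalerDr.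
by rewrite addrACA.
Qed.

Let cl_rep (v : hh R r) : end_alg Lam := mk_linmap (cl_act_lin v).

Let cl_repE v m : endapp (cl_rep v) m = cl_act v m. Proof. by []. Qed.

Let cl_rep_rel s t : clifford_rel G s t -> feval cl_rep s = feval cl_rep t.
Proof.
case=> [k u v|v v'] /=; apply: endapp_ext => m.
  rewrite endappD endappZ !cl_repE /cl_act /= contr_lin_y linearP mulrDl /=.
  by rewrite -pzscalerAl scalerDr addrACA.
rewrite endappD endappZ endapp1 !endappM !cl_repE /cl_act.
rewrite !contrD !contrM !mulrDr /cliffB scalerDl.
have qq u u' : qs (-1) u * (qs (-1) u' * m) + qs (-1) u' * (qs (-1) u * m) = 0.
  by rewrite !mulrA -mulrDl [X in X + _]qsC scaleN1r addNr mul0r.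
rewrite addrACA [X in X + _]addrACA contr_anti add0r [X in X + _]addrACA.
rewrite [X in _ + X]addrACA qq addr0 -opprD [qs _ _ * _ + _]addrC addrAC.
by rewrite addNr add0r addrC.
Qed.

Let aug : Lam -> reg_alg C := qlift (fun _ => 0).

Let aug_zero_lin : linear (fun _ : V => 0 : reg_alg C).
Proof. by move=> k u v; rewrite scaler0 addr0. Qed.

Let aug_zeroC (u v : V) : (0 : reg_alg C) * 0 = (-1) *: ((0 : reg_alg C) * 0).
Proof. by rewrite mulr0 scaler0. Qed.

(** The vacuum expectation of the action on the exterior algebra. *)
Lemma clifford_functional : exists l : Cl -> C,
  (forall k a b, l (k *: a + b) = k * l a + l b) /\ l 1 = 1.
Proof.
exists (fun a => aug (endapp (plift cl_rep a) 1)); split=> [k a b|].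
  rewrite (pliftP cl_rep_rel) endappD endappZ.
  by rewrite /aug (qlift_linear aug_zero_lin aug_zeroC).
by rewrite (plift1 cl_rep_rel) endapp1 /aug (qlift1 aug_zero_lin aug_zeroC).
Qed.

End CliffordFunctional.

(** * The reflection group and the positive roots *)

Section Isometry.
Context (R : realType) (r : nat) (G : 'M[R]_r).
Hypothesis Gip : inner_product G.
Implicit Types (a : 'cV[R]_r) (w : 'M[R]_r).

(** The matrices that preserve the inner product. *)
Definition inner_isometry w : Prop := w^T *m G *m w = G.

Lemma isometry_inner w : inner_isometry w ->
  forall u v, inner G (w *m u) (w *m v) = inner G u v.
Proof.
move=> wG u v; rewrite /inner trmx_mul -!mulmxA [w^T *m _]mulmxA.
by rewrite [_ *m (w *m v)]mulmxA wG.
Qed.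

Lemma isometry_inj w : inner_isometry w ->
  injective (fun v : 'cV[R]_r => w *m v).
Proof.
move=> wG u v uv; apply/eqP; rewrite -subr_eq0; apply: contraT => nz.
have := proj2 Gip _ nz; rewrite -(isometry_inner wG) mulmxBr uv subrr.
by rewrite /inner mulmx0 mxE ltxx.
Qed.

Lemma isometry1 : inner_isometry 1%:M.
Proof. by rewrite /inner_isometry trmx1 mul1mx mulmx1. Qed.

Lemma isometryM w w' : inner_isometry w -> inner_isometry w' ->
  inner_isometry (w *m w').
Proof.
move=> wG wG'; rewrite /inner_isometry trmx_mul -!mulmxA [w^T *m _]mulmxA.
by rewrite [_ *m (w *m w')]mulmxA wG mulmxA.
Qed.

Lemma isometryV w : inner_isometry w -> inner_isometry (invmx w).
Proof.
move=> wG; have [wu|wu] := boolP (w \in unitmx); last first.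
  by rewrite /invmx (negPf wu).
rewrite /inner_isometry -[in LHS]wG -!mulmxA mulmxV // mulmx1 mulmxA -trmx_mul.
by rewrite mulmxV // trmx1 mul1mx.
Qed.

Lemma refl_isometry a : inner G a a != 0 -> inner_isometry (refl G a).
Proof.
move=> aa; have rG : (refl G a)^T *m G = G *m refl G a.
  rewrite /refl /coroot -scalemxAl linearB linearZ /= trmx1 !trmx_mul trmxK.
  rewrite (proj1 Gip) mulmxBl mulmxBr mul1mx mulmx1 -scalemxAl -scalemxAr.
  by rewrite !mulmxA.
rewrite /inner_isometry rG -mulmxA -[RHS]mulmx1; congr (_ *m _).
rewrite [X in _ *m X]/refl mulmxBr mulmx1 (mulmxA (refl G a)) refl_coroot //.
rewrite mulNmx opprK.
by rewrite /refl subrK.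
Qed.

Lemma refl_conj w a : inner_isometry w -> refl G (w *m a) *m w = w *m refl G a.
Proof.
move=> wG; rewrite /refl /coroot mulmxBl mul1mx mulmxBr mulmx1; congr (_ - _).
rewrite (isometry_inner wG) -!scalemxAl -!scalemxAr trmx_mul; congr (_ *: _).
by rewrite -!mulmxA [w^T *m (G *m w)]mulmxA wG.
Qed.

Lemma coroot_isometry w a : inner_isometry w ->
  coroot G (w *m a) = w *m coroot G a.
Proof. by move=> wG; rewrite /coroot (isometry_inner wG) scalemxAr. Qed.

Lemma innerNN a : inner G (- a) (- a) = inner G a a.
Proof. by rewrite /inner mulmxN [(- a)^T]linearN !mulNmx opprK. Qed.

Lemma corootN a : coroot G (- a) = - coroot G a.
Proof. by rewrite /coroot innerNN scalerN. Qed.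

Lemma reflN a : refl G (- a) = refl G a.
Proof. by rewrite /refl corootN [(- a)^T]linearN !mulNmx mulmxN opprK. Qed.

End Isometry.

Section RootPermutation.
Context (R : realType) (r : nat) (G : 'M[R]_r) (Phi Phip : {fset 'cV[R]_r}).
Hypothesis Gip : inner_product G.
Hypothesis Phi_roots : root_system G Phi.
Hypothesis Phip_pos : positive_roots G Phi Phip.

Lemma root_opp a : a \in Phi -> - a \in Phi.
Proof.
move=> aP; rewrite -(refl_root (root_norm_neq0 Gip Phi_roots aP)).
by case: Phi_roots => _ h _; apply: h.
Qed.

Lemma isometry_perm w : inner_isometry G w ->
  (forall a, a \in Phi -> w *m a \in Phi) ->
  perm_eq [seq w *m a | a <- Phi] Phi.
Proof.
move=> wG wP; have u : uniq [seq w *m a | a <- Phi].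
  by rewrite map_inj_uniq ?fset_uniq //; exact: isometry_inj wG.
have sub : {subset [seq w *m a | a <- Phi] <= Phi}.
  by move=> _ /mapP[a aP ->]; apply: wP.

have [|_ h] := uniq_min_size u sub; first by rewrite size_map.
exact: uniq_perm u (fset_uniq _) h.
Qed.

Lemma refl_groupP w : refl_group G Phi w ->
  inner_isometry G w /\ forall a, a \in Phi -> w *m a \in Phi.
Proof.
elim=> [|a aP|w1 w2 _ [g1 p1] _ [g2 p2]|w1 _ [g1 p1]].
- by split=> [|a aP]; [exact: isometry1 | rewrite mul1mx].
- split; first exact: (refl_isometry Gip (root_norm_neq0 Gip Phi_roots aP)).
  by move=> b bP; case: Phi_roots => _ h _; apply: h.
- split; first exact: isometryM.
  by move=> a aP; rewrite -mulmxA; apply/p1/p2.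
- split; first exact: isometryV.
  move=> b bP; have [wu|wu] := boolP (w1 \in unitmx); last first.
    by rewrite /invmx (negPf wu); apply: p1.
  have := perm_mem (isometry_perm g1 p1) b; rewrite bP => /mapP[a aP ->].
  by rewrite mulmxA mulVmx // mul1mx.
Qed.

Lemma Phi_split : perm_eq Phi (Phip ++ [seq - a | a <- Phip]).
Proof.
have [t [t0 tP]] := Phip_pos.
have innerN a : inner G (- a) t = - inner G a t.
  by rewrite /inner [(- a)^T]linearN !mulNmx mxE.
apply: uniq_perm; first exact: fset_uniq.
  rewrite cat_uniq fset_uniq map_inj_uniq ?fset_uniq ?andbT /=;
    last exact: oppr_inj.
  apply/hasPn => _ /mapP[a aP ->]; move: aP; rewrite !tP innerN => /andP[_ a0].
  by rewrite oppr_gt0 ltNge (ltW a0) andbF.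
move=> a; rewrite mem_cat; apply/idP/idP => [aP|].
  have := t0 a aP; rewrite neq_lt => /orP[a0|a0]; last by rewrite tP aP a0.
  apply/orP; right; rewrite -[a]opprK; apply: map_f.
  by rewrite tP root_opp //= innerN oppr_gt0.
case/orP => [|/mapP[b bP ->]]; first by rewrite tP => /andP[].
by apply: root_opp; move: bP; rewrite tP => /andP[].
Qed.

(** A sum over the positive roots of an even function is invariant under
    the reflection group. *)
Lemma sum_positive_roots (C : numFieldType) (W : lmodType C)
    (F : 'cV[R]_r -> W) w :
  (forall a, a \in Phi -> F (- a) = F a) -> refl_group G Phi w ->
  \sum_(a <- Phip) F (w *m a) = \sum_(a <- Phip) F a.
Proof.
move=> FN /refl_groupP[wG wP].
have dbl (F' : 'cV[R]_r -> W) : (forall a, a \in Phi -> F' (- a) = F' a) ->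
    \sum_(a <- Phi) F' a = 2 *: \sum_(a <- Phip) F' a.
  move=> FN'; rewrite (perm_big _ Phi_split) big_cat big_map /=.
  rewrite scaler_nat mulr2n.
  congr (_ + _); rewrite big_seq [RHS]big_seq; apply: eq_bigr => a aP.
  by apply/FN'/(Phip_sub Phip_pos).
have inj2 (u v : W) : 2 *: u = 2 *: v -> u = v.
  by move/(congr1 ( *:%R 2^-1)); rewrite !scalerA mulVf ?pnatr_eq0 // !scale1r.
apply: inj2; rewrite -(dbl _ FN) -(dbl (fun a => F (w *m a))) => [|a aP].
  by rewrite -[RHS](perm_big _ (isometry_perm wG wP)) big_map.
by rewrite mulmxN FN // wP.
Qed.

End RootPermutation.

(** * Dunkl operators *)

Section MatrixAction.
Context (C : comPzRingType) (r : nat).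
Local Notation V := 'cV[C]_r.
Local Notation S := (@qsym C V 1).

(** The action of a matrix on the symmetric algebra by an algebra
    endomorphism. *)
Definition mxact (M : 'M[C]_r) : S -> S := qlift (fun v => qs 1 (M *m v) : S).

Fact mxact_gen_lin M : linear (fun v : V => qs 1 (M *m v) : S).
Proof. by move=> k u v; rewrite mulmxDr -scalemxAr linearP. Qed.

Fact mxact_genC M (u v : V) :
  qs 1 (M *m u) * qs 1 (M *m v) = 1 *: (qs 1 (M *m v) * qs 1 (M *m u)) :> S.
Proof. exact: qsC. Qed.

Lemma mxact_linear M : linear (mxact M).
Proof. exact: (qlift_linear (mxact_gen_lin M) (mxact_genC M)). Qed.

HB.instance Definition _ M := GRing.isLinear.Build C S S *:%R (mxact M)
  (mxact_linear M).

Lemma mxact1 M : mxact M 1 = 1.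
Proof. exact: (qlift1 (mxact_gen_lin M) (mxact_genC M)). Qed.

Lemma mxactM M v m : mxact M (qs 1 v * m) = qs 1 (M *m v) * mxact M m.
Proof.
rewrite /mxact (qliftM (mxact_gen_lin M) (mxact_genC M)).
by rewrite (qlift_qs (mxact_gen_lin M) (mxact_genC M)).
Qed.

Lemma mxact_comp M N m : mxact M (mxact N m) = mxact (M *m N) m.
Proof.
elim/qsym_ind: m => [|k m m' IH IH'|v m IH].
- by rewrite !mxact1.
- by rewrite !linearP /= IH IH'.
- by rewrite !mxactM IH mulmxA.
Qed.

Lemma mxact_id m : mxact 1%:M m = m.
Proof.
elim/qsym_ind: m => [|k m m' IH IH'|v m IH].
- by rewrite !mxact1.
- by rewrite !linearP /= IH IH'.
- by rewrite !mxactM IH mul1mx.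
Qed.

End MatrixAction.

Section Dunkl.
Context (R : realType) (r : nat) (G : 'M[R]_r).
Context (Phi Phip : {fset 'cV[R]_r}) (c : 'cV[R]_r -> R[i]).
Hypothesis Gip : inner_product G.
Local Notation C := R[i].
Local Notation V := 'cV[C]_r.
Local Notation S := (@qsym C V 1).
Local Notation X := (@qs C V 1).
Local Notation refa a := (cplx (refl G a)).

Lemma cplx_reflE a v :
  refa a *m v = v - cpair G (cplx a) v *: cplx (coroot G a).
Proof.
rewrite /refl cplxB cplx1 mulmxBl mul1mx; congr (_ - _).
rewrite !cplxM -!mulmxA /cplx -map_trmx -/(cplx a) -/(cplx G).
rewrite [(cplx a)^T *m _]mulmxA [(cplx a)^T *m _ *m v]mx11_scalar.
by rewrite -/(cpair G _ v) mul_mx_scalar.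
Qed.

(** The value [dkl_step y u m] prescribed for [T_y (u m) - u T_y m], where [T_y]
    is the Dunkl operator and [u] is in [h^*], and the coefficient [dkl_coef a y u]
    of the reflection [s_a] in it. *)
Definition dkl_coef (a : 'cV[R]_r) (y u : V) : C :=
  c a * cpair G (cplx a) y * cpair G u (cplx (coroot G a)).

Definition dkl_step (y u : V) (m : S) : S :=
  cpair G u y *: m - \sum_(a <- Phip) dkl_coef a y u *: mxact (refa a) m.

(** [c_a (a, y) (u, a^v) (a, v)] is symmetric in [u] and [v]. *)
Lemma dkl_coefC a y u v :
  dkl_coef a y u * cpair G (cplx a) v = dkl_coef a y v * cpair G (cplx a) u.
Proof.
rewrite /dkl_coef /coroot cplxZ !cpairZr !(cpairC (proj1 Gip) (cplx a)).
move: (c a) (cpair _ _ _) (cpair _ u _) (cpair _ v _) (_%:C) => t p q q' k.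
ring.
Qed.

Lemma dkl_coef_linu a y k u v :
  dkl_coef a y (k *: u + v) = k * dkl_coef a y u + dkl_coef a y v.
Proof. by rewrite /dkl_coef cpairDl cpairZl mulrDr mulrCA. Qed.

Lemma dkl_coef_liny a u k y y' :
  dkl_coef a (k *: y + y') u = k * dkl_coef a y u + dkl_coef a y' u.
Proof. by rewrite /dkl_coef cpairDr cpairZr mulrDr mulrDl mulrCA -!mulrA. Qed.

Lemma dkl_step_linu y m : linear (dkl_step y ^~ m).
Proof.
move=> k u v.
rewrite /dkl_step cpairDl cpairZl scalerDl -scalerA scalerBr addrACA.
congr (_ + _); rewrite -opprD scaler_sumr -big_split; congr (- _).
by apply: eq_bigr => a _; rewrite dkl_coef_linu scalerDl scalerA.
Qed.

Lemma dkl_step_liny u m k y y' :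
  dkl_step (k *: y + y') u m = k *: dkl_step y u m + dkl_step y' u m.
Proof.
rewrite /dkl_step cpairDr cpairZr scalerDl -scalerA scalerBr addrACA.
congr (_ + _); rewrite -opprD scaler_sumr -big_split; congr (- _).
by apply: eq_bigr => a _; rewrite dkl_coef_liny scalerDl scalerA.
Qed.

Lemma dkl_step_linm y u : linear (dkl_step y u).
Proof.
move=> k m m'; rewrite /dkl_step scalerDr scalerBr !scalerA mulrC -scalerA.
rewrite addrACA scalerA; congr (_ + _); rewrite -opprD scaler_sumr -big_split.
congr (- _).
by apply: eq_bigr => a _; rewrite linearP scalerDr !scalerA mulrC.
Qed.

(** The values prescribed on [u v m] and [v u m] agree. *)
Lemma dkl_stepC y u v m :
  dkl_step y u (X v * m) + 1 *: (X u * dkl_step y v m) =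
  1 *: (dkl_step y v (X u * m) + 1 *: (X v * dkl_step y u m)).
Proof.
have E u' v' : dkl_step y u' (X v' * m) =
    cpair G u' y *: (X v' * m) -
      X v' * (\sum_(a <- Phip) dkl_coef a y u' *: mxact (refa a) m) +
    \sum_(a <- Phip) (dkl_coef a y u' * cpair G (cplx a) v') *:
      (X (cplx (coroot G a)) * mxact (refa a) m).
  rewrite /dkl_step -addrA; congr (_ + _).
  rewrite [RHS]addrC -[RHS]opprB mulr_sumr -sumrB; congr (- _).
  apply: eq_bigr => a _; rewrite mxactM cplx_reflE linearB linearZ /=.
  by rewrite mulrBl scalerBr -pzscalerAr -pzscalerAl scalerA.
rewrite !scale1r !E ![dkl_step y _ m]/dkl_step !mulrBr -!pzscalerAr.
rewrite addrAC [RHS]addrAC [X in _ = X + _]addrC; congr (_ + _).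
by apply: eq_bigr => a _; rewrite dkl_coefC.
Qed.

Lemma dunkl_ex (y : V) : exists T : S -> S,
  [/\ linear T, T 1 = 0 & forall u m, T (X u * m) = X u * T m + dkl_step y u m].
Proof.
have [T [Tlin T1 TM]] := twisted_derivation (dkl_step_linu y) (dkl_step_linm y)
  (dkl_stepC y).
by exists T; split=> // u m; rewrite TM scale1r.
Qed.

(** The Dunkl operator in the direction [y]. It is obtained without dividing
    by the roots: it is the operator that kills 1 and has the prescribed
    commutators with the multiplications. *)
Definition dunkl (y : V) : S -> S := sval (cid (dunkl_ex y)).

Lemma dunkl_linear y : linear (dunkl y).
Proof. by rewrite /dunkl; case: cid => T []. Qed.
Lemma dunkl1 y : dunkl y 1 = 0.
Proof. by rewrite /dunkl; case: cid => T []. Qed.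
Lemma dunklM y u m : dunkl y (X u * m) = X u * dunkl y m + dkl_step y u m.
Proof. by rewrite /dunkl; case: cid => T [_ _ /= ->]. Qed.

HB.instance Definition _ y := GRing.isLinear.Build C S S *:%R (dunkl y)
  (dunkl_linear y).

Lemma dunkl_liny k y y' m : dunkl (k *: y + y') m = k *: dunkl y m + dunkl y' m.
Proof.
elim/qsym_ind: m => [|t m m' IH IH'|u m IH].
- by rewrite !dunkl1 scaler0 addr0.
- rewrite !dunkl_linear IH IH' !scalerDr !scalerA [t * k]mulrC.
  by rewrite -!addrA; congr (_ + _); rewrite addrCA.
- rewrite !dunklM IH dkl_step_liny mulrDr -pzscalerAr addrACA.
  by rewrite -scalerDr.
Qed.

End Dunkl.

Section DunklTheory.
Context (R : realType) (r : nat) (G : 'M[R]_r).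
Context (Phi Phip : {fset 'cV[R]_r}) (c : 'cV[R]_r -> R[i]).
Hypothesis Gip : inner_product G.
Hypothesis Phi_roots : root_system G Phi.
Hypothesis Phip_pos : positive_roots G Phi Phip.
Hypothesis c_inv : W_invariant G Phi c.
Local Notation C := R[i].
Local Notation V := 'cV[C]_r.
Local Notation S := (@qsym C V 1).
Local Notation X := (@qs C V 1).
Local Notation refa a := (cplx (refl G a)).
Local Notation T y := (dunkl Phip c Gip y).
Local Notation coef := (dkl_coef G c).
Local Notation step := (dkl_step G Phip c).

Lemma cpair_isometry w u v : inner_isometry G w ->
  cpair G (cplx w *m u) (cplx w *m v) = cpair G u v.
Proof.
move=> wG; rewrite /cpair trmx_mul /cplx map_trmx -!mulmxA.
rewrite (mulmxA _ _ v) -map_mxM (mulmxA _ _ v) -map_mxM.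
by rewrite [w^T *m _]mulmxA wG mulmxA.
Qed.

Lemma c_opp a : a \in Phi -> c (- a) = c a.
Proof.
move=> aP; rewrite -(refl_root (root_norm_neq0 Gip Phi_roots aP)).
exact: c_inv (RGrefl G aP) aP.
Qed.

Lemma coefN a y u : a \in Phi -> coef (- a) y u = coef a y u.
Proof.
move=> aP; rewrite /dkl_coef c_opp // corootN !cplxN cpairNl cpairNr.
by rewrite !mulrN mulNr opprK.
Qed.

Lemma step_equivariant w y u m : refl_group G Phi w ->
  mxact (cplx w) (step y u m) =
  step (cplx w *m y) (cplx w *m u) (mxact (cplx w) m).
Proof.
move=> wW; have [wG wP] := refl_groupP Gip Phi_roots wW.
rewrite /dkl_step linearB linearZ linear_sum /= (cpair_isometry _ _ wG).
congr (_ - _).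
pose F a := coef a (cplx w *m y) (cplx w *m u) *:
  mxact (refa a) (mxact (cplx w) m).
rewrite -[RHS](sum_positive_roots Gip Phi_roots Phip_pos (F := F) _ wW); last first.
  by move=> a aP; rewrite /F coefN // reflN.
rewrite big_seq [RHS]big_seq; apply: eq_bigr => a /(Phip_sub Phip_pos) aP.
rewrite linearZ /= /F !mxact_comp -!cplxM refl_conj //; congr (_ *: _).
rewrite /dkl_coef (c_inv wW aP) coroot_isometry // !cplxM.
by rewrite !(cpair_isometry _ _ wG).
Qed.

Lemma dunkl_equivariant w y m : refl_group G Phi w ->
  mxact (cplx w) (T y m) = T (cplx w *m y) (mxact (cplx w) m).
Proof.
move=> wW; elim/qsym_ind: m => [|k m m' IH IH'|u m IH].
- by rewrite mxact1 !dunkl1 linear0.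
- by rewrite !(dunkl_linear, mxact_linear) IH IH'.
- by rewrite dunklM linearD /= !mxactM dunklM IH step_equivariant.
Qed.

Lemma dunkl_sum (I : Type) (s : seq I) (F : I -> S) y :
  T y (\sum_(i <- s) F i) = \sum_(i <- s) T y (F i).
Proof. exact: linear_sum. Qed.

Lemma dunklB y m m' : T y (m - m') = T y m - T y m'.
Proof. exact: linearB. Qed.

Lemma dunklD y m m' : T y (m + m') = T y m + T y m'.
Proof. exact: linearD. Qed.

Lemma dunklZ y k m : T y (k *: m) = k *: T y m.
Proof. exact: linearZ. Qed.

Lemma dunkl_refl a y m : a \in Phi ->
  mxact (refa a) (T y m) =
  T y (mxact (refa a) m) -
    cpair G (cplx a) y *: T (cplx (coroot G a)) (mxact (refa a) m).
Proof.
move=> aP; rewrite (dunkl_equivariant _ _ (RGrefl G aP)) cplx_reflE addrC.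
by rewrite -scaleNr dunkl_liny scaleNr addrC.
Qed.

(** The commutator of two Dunkl operators commutes with the multiplications
    and kills 1. *)
Lemma dunklC y y' m : T y (T y' m) = T y' (T y m).
Proof.
elim/qsym_ind: m => [|k m m' IH IH'|u m IH].
- by rewrite !dunkl1 !linear0.
- by rewrite !dunkl_linear IH IH'.
(* After moving the reflections to the right of the Dunkl operators, all three
   sums are symmetric in [z] and [z']. *)
have E z z' : step z u (T z' m) + T z (step z' u m) =
  cpair G u z *: T z' m + cpair G u z' *: T z m -
  \sum_(a <- Phip) (coef a z u *: T z' (mxact (refa a) m) +
                    coef a z' u *: T z (mxact (refa a) m)) +
  \sum_(a <- Phip) (coef a z u * cpair G (cplx a) z') *:
     T (cplx (coroot G a)) (mxact (refa a) m).
  rewrite /dkl_step dunklB dunklZ dunkl_sum addrACA -[RHS]addrA.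
  congr (_ + _); rewrite -opprD -[RHS]opprK [in RHS]opprD opprK -sumrB -big_split.
  congr (- _); rewrite big_seq [RHS]big_seq.
  apply: eq_bigr => a /(Phip_sub Phip_pos) aP /=.
  by rewrite dunklZ dunkl_refl // scalerBr scalerA addrAC.
have M z z' : T z (T z' (X u * m)) =
    X u * T z (T z' m) + (step z u (T z' m) + T z (step z' u m)).
  by rewrite dunklM (dunklD z (X u * _)) dunklM -addrA.
rewrite !M IH; congr (_ + _).
rewrite !E; congr (_ - _ + _).
- exact: addrC.
- by apply: eq_bigr => a _; rewrite addrC.
- apply: eq_bigr => a _; congr (_ *: _); rewrite /dkl_coef.
  by rewrite mulrAC [RHS]mulrAC; congr (_ * _); rewrite mulrAC.
Qed.

End DunklTheory.

(** * The polynomial representation *)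

Section PolynomialRep.
Context (R : realType) (r : nat) (G : 'M[R]_r).
Context (Phi Phip : {fset 'cV[R]_r}) (c : 'cV[R]_r -> R[i]).
Hypothesis Gip : inner_product G.
Hypothesis Phi_roots : root_system G Phi.
Hypothesis Phip_pos : positive_roots G Phi Phip.
Hypothesis c_inv : W_invariant G Phi c.
Local Notation C := R[i].
Local Notation V := 'cV[C]_r.
Local Notation S := (@qsym C V 1).
Local Notation X := (@qs C V 1).
Local Notation refa a := (cplx (refl G a)).
Local Notation T y := (dunkl Phip c Gip y).
Local Notation coef := (dkl_coef G c).
Local Notation step := (dkl_step G Phip c).

(** The operators by which the generators act. *)

Definition pol_act (g : hh R r + reflW G Phi) (m : S) : S :=
  match g with
  | inl v => T v.1 m + X v.2 * m
  | inr w => mxact (cplx (val w)) m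
  end.

Lemma pol_act_linear g : linear (pol_act g).
Proof.
move=> k m m'; case: g => [v|w] /=; last exact: mxact_linear.
rewrite dunkl_linear mulrDr -pzscalerAr scalerDr.
by rewrite addrACA.
Qed.

Definition pol_gen g : end_alg S := mk_linmap (pol_act_linear g).

Lemma pol_genE g m : endapp (pol_gen g) m = pol_act g m. Proof. by []. Qed.

Lemma reflW_group (w : reflW G Phi) : refl_group G Phi (val w).
Proof. exact: set_mem (valP w). Qed.

Lemma dunkl0 m : T 0 m = 0.
Proof.
by have := dunkl_liny Phip c Gip (-1) 0 0 m; rewrite scaler0 addr0 scaleN1r addNr.
Qed.

Lemma feval_sum (K : pzRingType) (Y : Type) (A : pzAlgType K) (f : Y -> A)
    (I : Type) (s : seq I) (F : I -> fterm K Y) :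
  feval f (\big[@FAdd K Y/FZero]_(i <- s) F i) = \sum_(i <- s) feval f (F i).
Proof. by elim: s => [|i s IH]; rewrite ?big_nil // !big_cons /= IH. Qed.

Lemma pol_gen_rel s t : cherednik_rel Phip c s t ->
  feval pol_gen s = feval pol_gen t.
Proof.
case=> [k u v||w1 w2 w ww|w y x|y y'|x x'|y x] /=; apply: endapp_ext => m.
- rewrite endappD endappZ !pol_genE /= dunkl_liny linearP mulrDl -pzscalerAl.
  by rewrite scalerDr addrACA.
- by rewrite endapp1 pol_genE /= cplx1 mxact_id.
- by rewrite endappM !pol_genE /= ww mxact_comp cplxM.
- rewrite !endappM !pol_genE /= linearD /= mxactM.
  by rewrite (dunkl_equivariant Gip Phi_roots Phip_pos c_inv _ _ (reflW_group w)).
- rewrite endappD endappN !endappM !pol_genE /= linear0 !mul0r !addr0.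
  by rewrite (dunklC Gip Phi_roots Phip_pos c_inv) subrr.
- rewrite endappD endappN !endappM !pol_genE /= !dunkl0 !add0r !mulrA qsC.
  by rewrite scale1r subrr.
- rewrite !endappD !endappN !endappM endappZ endapp1 !pol_genE feval_sum endapp_sum.
  rewrite /= !dunkl0 linear0 !mul0r !add0r !addr0 dunklM addrAC subrr add0r.
  rewrite /dkl_step; congr (_ - _); rewrite big_seq [RHS]big_seq.
  apply: eq_bigr => a /(Phip_sub Phip_pos) aP.
  by rewrite -(val_sW G aP).
Qed.

Local Notation Hc := (cherednik G Phi Phip c).

(** The polynomial representation of the rational Cherednik algebra: [x] acts
    by multiplication, [y] by the Dunkl operator, [W] by its linear action. *)
Definition pol_rep : Hc -> end_alg S := plift pol_gen.

Lemma pol_rep_linear : linear pol_rep. Proof. exact: (pliftP pol_gen_rel). Qed.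
Lemma pol_rep1 : pol_rep 1 = 1. Proof. exact: (plift1 pol_gen_rel). Qed.
Lemma pol_repM a b : pol_rep (a * b) = pol_rep a * pol_rep b.
Proof. exact: (pliftM pol_gen_rel). Qed.
Lemma pol_rep_x v m : endapp (pol_rep (Hgx G Phi Phip c v)) m = X v * m.
Proof. by rewrite /pol_rep (plift_gen pol_gen_rel) pol_genE /= dunkl0 add0r. Qed.

HB.instance Definition _ := GRing.isLinear.Build C Hc (end_alg S) *:%R pol_rep
  pol_rep_linear.

Lemma pol_repZ k a : pol_rep (k *: a) = k *: pol_rep a.
Proof. exact: linearZ. Qed.

Lemma pol_rep_sum (I : Type) (s : seq I) (F : I -> Hc) :
  pol_rep (\sum_(i <- s) F i) = \sum_(i <- s) pol_rep (F i).
Proof. exact: linear_sum. Qed.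

Lemma pol_rep_sum_sqr (I : Type) (s : seq I) (k : C) (v : I -> V) :
  endapp (pol_rep (\sum_(i <- s) k *: Hgx G Phi Phip c (v i) ^+ 2)) 1 =
  \sum_(i <- s) k *: (X (v i) * X (v i)).
Proof.
rewrite pol_rep_sum endapp_sum; apply: eq_bigr => i _.
by rewrite pol_repZ endappZ expr2 pol_repM endappM !pol_rep_x mulr1.
Qed.

(** * A module over the tensor product *)

Local Notation Cl := (clifford G).
Let U : lmodType C := linmap Cl S.

(* An elementary tensor [a (x) w] maps [F] to [u |-> a F(u w)]. *)
Let hc_fun (g : Hc * Cl) (F : U) (u : Cl) : S := endapp (pol_rep g.1) (F (u * g.2)).

Let hc_fun_linear g F : linear (hc_fun g F).
Proof.
move=> k u v.
by rewrite /hc_fun mulrDl -pzscalerAl linmapP endapp_linear.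
Qed.

Let hc_act (g : Hc * Cl) (F : U) : U := mk_linmap (@hc_fun_linear g F).

Let hc_actE g F u : hc_act g F u = endapp (pol_rep g.1) (F (u * g.2)).
Proof. by []. Qed.

Let hc_act_linear g : linear (hc_act g).
Proof.
move=> k F F'; apply: linmap_ext => u.
by rewrite linmapD linmapZ !hc_actE linmapD linmapZ endapp_linear.
Qed.

Let hc_gen g : end_alg U := mk_linmap (hc_act_linear g).

Let hc_genE g F : endapp (hc_gen g) F = hc_act g F. Proof. by []. Qed.

Let hc_gen_rel s t : @tens_rel C Hc Cl s t -> feval hc_gen s = feval hc_gen t.
Proof.
case=> [k a a' u|k a u u'|a a' u u'|] /=; apply: endapp_ext => F;
  apply: linmap_ext => v.
- rewrite endappD endappZ !hc_genE linmapD linmapZ !hc_actE /=.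
  by rewrite pol_rep_linear endappD endappZ.
- rewrite endappD endappZ !hc_genE linmapD linmapZ !hc_actE /=.
  by rewrite mulrDr -pzscalerAr linmapP endapp_linear.
- by rewrite endappM !hc_genE !hc_actE /= pol_repM endappM mulrA.
- by rewrite endapp1 hc_genE hc_actE /= pol_rep1 mulr1.
Qed.

(** The witness is the map [u |-> l(u) 1], for a functional [l] on the Clifford
    algebra with [l(1) = 1]. *)
Lemma tens1_neq0 (a : Hc) : endapp (pol_rep a) 1 != 0 ->
  (tens a 1 : tensor Hc Cl) != 0.
Proof.
apply: contraNneq => a0.
have [l [l_lin l1]] := clifford_functional G.
have F_lin : linear (fun u : Cl => l u *: (1 : S)).
  by move=> k u v; rewrite l_lin scalerDl scalerA.
pose F : U := mk_linmap F_lin.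
have := congr1 (fun t => endapp (plift hc_gen t) F 1) a0.
rewrite /= (plift_gen hc_gen_rel) hc_genE hc_actE /= mulr1 l1 scale1r => ->.
have p0 : plift hc_gen (0 : tensor Hc Cl) = 0.
  have := pliftP hc_gen_rel (-1) 0 0.
  by rewrite scaler0 addr0 scaleN1r addNr.
by rewrite p0.
Qed.

End PolynomialRep.

(** * Non-vanishing of [E_1^+], and the isomorphism *)

Section NonVanishing.
Context (R : realType) (r : nat) (G : 'M[R]_r).
Context (Phi Phip : {fset 'cV[R]_r}) (c : 'cV[R]_r -> R[i]).
Hypothesis Gip : inner_product G.
Hypothesis Phi_roots : root_system G Phi.
Hypothesis Phip_pos : positive_roots G Phi Phip.
Hypothesis c_inv : W_invariant G Phi c.
Context (y : 'I_r -> 'cV[R]_r).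
Hypothesis y_on : orthonormal_family G y.
Local Notation C := R[i].
Local Notation V := 'cV[C]_r.
Local Notation S := (@qsym C V 1).

Lemma elE1p_neq0 : (0 < r)%N -> elE1p G Phi Phip c y != 0.
Proof.
move=> r0; pose i0 := Ordinal r0; pose b i : V := cplx (y i).
have bP i j : cpair G (b i) (b j) = (i == j)%:R := b_on y_on i j.
pose q : cherednik G Phi Phip c := \sum_i 2^-1 *: Hgx G Phi Phip c (b i) ^+ 2.
suff: endapp (@pol_rep R r G Phi Phip c Gip q) 1 != 0.
  by move/(tens1_neq0 Phi_roots Phip_pos c_inv) => q0; rewrite oppr_eq0; exact: q0.
(* Evaluation of polynomials at the point [y_0], where [sum_i x_i^2] is 1. *)
pose ev : S -> reg_alg C := qlift (fun v => cpair G v (b i0) : reg_alg C).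
have ev_lin : linear (fun v : V => cpair G v (b i0) : reg_alg C).
  by move=> k u v; rewrite cpairDl cpairZl.
have evC (u v : V) : (cpair G u (b i0) : reg_alg C) * cpair G v (b i0) =
    1 *: ((cpair G v (b i0) : reg_alg C) * cpair G u (b i0)).
  by rewrite scale1r; exact: mulrC.
pose evl : {linear S -> reg_alg C} :=
  HB.pack ev (GRing.isLinear.Build C S (reg_alg C) *:%R ev
    (qlift_linear ev_lin evC)).
have evX u : ev (qs 1 u * qs 1 u) = cpair G u (b i0) ^+ 2.
  by rewrite /ev (qliftM ev_lin evC) !(qlift_qs ev_lin evC).
rewrite (pol_rep_sum_sqr Gip Phi_roots Phip_pos c_inv).
apply: contra_neq (_ : (2^-1 : C) != 0); last by rewrite invr_eq0 pnatr_eq0.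
have evE i : evl (2^-1 *: (qs 1 (b i) * qs 1 (b i))) = 2^-1 * (i == i0)%:R.
  rewrite (_ : evl _ = 2^-1 *: evl (qs 1 (b i) * qs 1 (b i)));
    last exact: linearZ.
  by rewrite [evl _]evX bP; congr (_ * _); case: eqP; rewrite ?expr1n ?expr0n.
move/(congr1 evl); rewrite linear0 linear_sum (eq_bigr _ (fun i _ => evE i)).
rewrite (bigD1 i0) // big1 => [|i /negPf ->]; last exact: mulr0.
by rewrite eqxx mulr1 => h; apply: etrans h; exact: esym (addr0 _).
Qed.

End NonVanishing.

Theorem theorem4p2 (R : realType) (r : nat) (G : 'M[R]_r)
    (Phi Phip : {fset 'cV[R]_r}) (c : 'cV[R]_r -> R[i])
    (y x : 'I_r -> 'cV[R]_r) :
  (0 < r)%N ->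
  inner_product G ->
  root_system G Phi ->
  positive_roots G Phi Phip ->
  W_invariant G Phi c ->
  orthonormal_family G y ->
  dual_basis G y x ->
  let A := HC G Phi Phip c in
  let g : set A := g_span G Phi Phip c y x in
  lie_superalgebra (@homog _ A) (@scomm _ A) g /\
  lie_superalgebra_iso (@homog _ A) (@scomm _ A) g
    (@homog _ (mx_super R[i] 2 2)) (@scomm _ (mx_super R[i] 2 2))
    (@spo22 R[i]).
Proof.
move=> r0 Gip Phi_roots Phip_pos c_inv y_on xy A g.
have xE := dual_basis_eq Gip y_on xy; subst x.
have rel := cherednik_spo_rel c Gip Phi_roots Phip_pos y_on.
have free := spo_free rel (elE1p_neq0 Gip Phi_roots Phip_pos c_inv y_on r0).
have gE : g = range (lincomb (spo_fam
    (elH G Phi Phip c y y) (elZ G Phi Phip c y y)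
    (elE1p G Phi Phip c y) (elE1m G Phi Phip c y) (elE2p G Phi Phip c y y)
    (elE2m G Phi Phip c y y) (elE3p G Phi Phip c y) (elE3m G Phi Phip c y))).
  apply/seteqP; split=> [_ [k ->]|_ [k _ <-]].
    exists (\row_i k i) => //; rewrite /lincomb.
    by apply: eq_bigr => i _; rewrite mxE.
  by exists (fun i => k 0 i).
rewrite gE -range_spo_mx; split.
  exact: structure_lie_superalgebra (spo_structure rel).
exact: structure_iso (spo_structure rel) (@spo_mx_structure _) free (@spo_mx_free _).
Qed.
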